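(* (1) A topological group is TNA if and only if it is isomorphic (as a topological group) to a subgroup of $\mathrm{Sym}(\Omega)$ for some set $\Omega$. Specifically, for a topological group $G$ and an infinite cardinal $\kappa$, the following are equivalent: (a) $G$ is isomorphic to a subgroup of $\mathrm{Sym}(\kappa)$; (b) $G$ is TNA and $w(G)\leq\kappa$; (c) $G$ is TNA, $c(G)\leq\kappa$ and $\chi(G)\leq\kappa$. (2) An Abelian topological group is TNA if and only if it is isomorphic (as a topological group) to a subgroup of a direct product of discrete groups. Moreover, for an Abelian topological group $A$ and an infinite cardinal $\kappa$, the following are equivalent: (a) $A$ is isomorphic to a subgroup of the direct product of $\kappa$ or fewer discrete groups each of size at most $\kappa$; (b) $A$ is isomorphic to a subgroup of $$\prod_\kappa\left(\bigoplus_\kappa\mathbf{Q}\oplus\bigoplus_{p\ \mathrm{prime}}\ \bigoplus_\kappa\mathbf{Z}(p^\infty)\right)_d;$$ (c) $A$ is TNA and $w(A)\leq\kappa$; (d) $A$ is TNA, $c(A)\leq\kappa$ and $\chi(A)\leq\kappa$.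
   Context: All topological groups are assumed to be Hausdorff; subgroups carry the subspace topology, direct products the product topology, and ''isomorphic'' means isomorphic as topological groups. A topological group is topologically non-Archimedean (TNA) if every neighborhood of the neutral element contains an open subgroup. For a set $\Omega$, $\mathrm{Sym}(\Omega)$ denotes the symmetric group on $\Omega$ (all bijections $\Omega\to\Omega$), topologized as a subspace of the product ${}^{\Omega}\Omega$ of all functions $\Omega\to\Omega$, with $\Omega$ discrete; this makes it a topological group. For a topological space $X$, the weight, cellularity and character are $$w(X)=\min\{|\mathcal{B}|:\mathcal{B}\text{ a base for }X\}+\aleph_0,$$ $$c(X)=\sup\{|\mathcal{V}|:\mathcal{V}\text{ a disjoint family of open sets in }X\}+\aleph_0,$$ $$\chi(X)=\sup\{\chi(p,X):p\in X\}+\aleph_0,\quad\text{where }\chi(p,X)=\min\{|\mathcal{V}|:\mathcal{V}\text{ a local base for }p\}.$$ $\mathbf{Z}(p^\infty)$ is the quasicyclic (Prüfer) $p$-group, $\bigoplus_\kappa$ and $\prod_\kappa$ denote the direct sum and direct product of $\kappa$ copies, and $(\cdot)_d$ denotes the topological group obtained by endowing a group with the discrete topology. *)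

(* Defs.v *)
From HB Require Import structures.
From mathcomp Require Import all_boot all_order all_algebra all_field.
From mathcomp Require Import all_classical all_reals topology.

Set Implicit Arguments.
Unset Strict Implicit.
Unset Printing Implicit Defensive.

Local Open Scope classical_set_scope.
Local Open Scope card_scope.
Local Open Scope group_scope.

(** * Cardinal invariants

    A cardinal is represented by a set having that cardinality. *)

Lemma least_card {U : Type} (F : set (set U)) : F !=set0 ->
  exists A, F A /\ forall B, F B -> A #<= B.
Proof.
move=> F0; pose J := set_type F.
pose ok (S : set (J -> U)) := forall j : J,
  (forall x, S x -> val j (x j)) /\ {in S &, injective (fun x => x j)}.
have [S [okS maxS]] : exists S, ok S /\ forall T, S `<` T -> ~ ok T.
  apply: Zorn_bigcup => C Cok Ctot j; split.
    by move=> x [T CT Tx]; have [+ _] := Cok _ CT j; apply.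
  move=> x y; rewrite !inE => -[T CT Tx] [T' CT' T'y].
  have [TT'|T'T] := Ctot _ _ CT CT'.
    by have [_ i] := Cok _ CT' j; apply: i; rewrite inE //; exact: TT'.
  by have [_ i] := Cok _ CT j; apply: i; rewrite inE //; exact: T'T.
have [j jS] : exists j : J, val j `<=` (fun x => x j) @` S.
  apply: contrapT => /forallNP noj.
  have /choice[y yP] : forall j : J, exists u : U,
      val j u /\ ~ ((fun x => x j) @` S) u.
    by move=> j; have /existsNP[u /not_implyP] := noj j; exists u.
  apply: (maxS (S `|` [set y])).
    split; first by left.
    have [j0 Fj0] := F0; pose j : J := SigSub (mem_set Fj0).
    move=> /(_ y (or_intror erefl)) Sy.
    by have [_] := yP j; apply; exists y.
  move=> j; have [Sj ij] := okS j; have [yj nyj] := yP j; split.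
    by move=> x [/Sj//|->].
  move=> x z; rewrite !inE => -[Sx|->] [Sz|->] // xz.
  - by apply: ij; rewrite ?inE.
  - by exfalso; apply: nyj; exists x.
  - by exfalso; apply: nyj; exists z.
have cardS k : (fun x => x k) @` S #= S.
  by apply: inj_card_eq; have [] := okS k.
exists (val j); split; first exact: (set_mem (valP j)).
move=> B FB; pose k : J := SigSub (mem_set FB).
apply: card_le_trans (subset_card_le jS) _.
rewrite (card_le_eql (cardS j)) -(card_le_eql (cardS k)).
by apply: subset_card_le => _ [x Sx <-]; have [+ _] := okS k; exact.
Qed.

Definition min_card {U : Type} (F : set (set U)) : set U :=
  xget set0 [set A | F A /\ forall B, F B -> A #<= B].

Lemma min_cardP {U : Type} (F : set (set U)) : F !=set0 ->
  F (min_card F) /\ forall B, F B -> min_card F #<= B.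
Proof.
move=> /least_card[A A_least].
apply: (@xgetPex _ set0 [set A | F A /\ forall B, F B -> A #<= B]).
by exists A.
Qed.

(* The supremum is taken in the class of all cardinals; as [setT] is an upper
   bound, it is enough to minimize over subsets of [U], see [sup_card_leP]. *)
Definition sup_card {U : Type} (F : set (set U)) : set U :=
  min_card [set A | forall B, F B -> B #<= A].

Lemma card_le_total {U T : Type} (A : set U) (B : set T) :
  (A #<= B) \/ (B #<= A).
Proof.
have cl : (@inl U T) @` A #= A by apply: inj_card_eq => x y _ _ [].
have cr : (@inr U T) @` B #= B by apply: inj_card_eq => x y _ _ [].
have [|C [CAB leC]] := @least_card (U + T) [set inl @` A; inr @` B].
  by exists (inl @` A); left.
case: CAB leC => -> leC; [left|right].
  by rewrite -(card_le_eql cl) -(card_le_eqr cr); apply: leC; right.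
by rewrite -(card_le_eql cr) -(card_le_eqr cl); apply: leC; left.
Qed.

Lemma sup_card_leP {U T : Type} (F : set (set U)) (K : set T) :
  sup_card F #<= K <-> forall B, F B -> B #<= K.
Proof.
have ubT B : F B -> B #<= [set: U] by move=> _; exact: subset_card_le.
have [ub least] : (forall B, F B -> B #<= sup_card F) /\
    forall A : set U, (forall B, F B -> B #<= A) -> sup_card F #<= A.
  apply: (@min_cardP U [set A | forall B, F B -> B #<= A]).
  by exists setT; exact: ubT.
split=> [FK B FB|FK]; first exact: card_le_trans (ub B FB) FK.
have [UK|] := card_le_total [set: U] K.
  exact: card_le_trans (least _ ubT) UK.
case/card_subP => C CK _; rewrite -(card_le_eqr CK); apply: least => B FB.
by rewrite (card_le_eqr CK); exact: FK.
Qed.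

Definition add_aleph0 {U : Type} (A : set U) : set (U + nat) :=
  [set x | if x is inl a then A a else True].

Definition weight (X : topologicalType) : set (set X + nat) :=
  add_aleph0 (min_card [set B | basis B]).

Definition disjoint_open_family {X : topologicalType} (V : set (set X)) :=
  V `<=` open /\ trivIset V id.

Definition cellularity (X : topologicalType) : set (set X + nat) :=
  add_aleph0 (sup_card [set V | @disjoint_open_family X V]).

Definition local_base {X : topologicalType} (p : X) (V : set (set X)) :=
  V `<=` open_nbhs p /\ filter_from V id --> p.

Definition character_at {X : topologicalType} (p : X) : set (set X) :=
  min_card [set V | local_base p V].

Definition character (X : topologicalType) : set (set X + nat) :=
  add_aleph0 (sup_card (range (@character_at X))).

Arguments weight X : clear implicits.
Arguments cellularity X : clear implicits.
Arguments character X : clear implicits.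

(** * Topological groups *)

HB.mixin Record isTopologicalGroup G & Topological G & Group G := {
  mulg_continuous : continuous (fun x : G * G => x.1 * x.2);
  invg_continuous : continuous (fun x : G => x^-1)
}.

#[short(type="topologicalGroupType")]
HB.structure Definition TopologicalGroup :=
  {G of Topological G & Group G & isTopologicalGroup G}.

Record subgroup (G : groupType) := Subgroup {
  subgroup_set : set G;
  subgroup_closed : group_closed [in subgroup_set]
}.

Definition subgroup_type {G : groupType} (S : subgroup G) : Type :=
  set_type (subgroup_set S).
Coercion subgroup_type : subgroup >-> Sortclass.

HB.instance Definition _ (G : groupType) (S : subgroup G) :=
  SubChoice.copy (subgroup_type S) (set_type (subgroup_set S)).
HB.instance Definition _ (G : groupType) (S : subgroup G) :=
  SubChoice_isSubGroup.Build G _ (subgroup_type S) (subgroup_closed S).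

HB.instance Definition _ (G : topologicalGroupType) (S : subgroup G) :=
  Topological.copy (subgroup_type S) (set_type (subgroup_set S)).

Lemma continuous_pair {X Y Z : topologicalType} (f : X -> Y) (g : X -> Z) :
  continuous f -> continuous g -> continuous (fun x => (f x, g x)).
Proof. by move=> cf cg x; apply: cvg_pair; [exact: cf|exact: cg]. Qed.

Lemma continuous_fst {X Y : topologicalType} : continuous (@fst X Y).
Proof. by move=> x; exact: cvg_fst. Qed.

Lemma continuous_snd {X Y : topologicalType} : continuous (@snd X Y).
Proof. by move=> x; exact: cvg_snd. Qed.

Lemma continuous_compT {X Y Z : topologicalType} (f : X -> Y) (g : Y -> Z) :
  continuous f -> continuous g -> continuous (g \o f).
Proof. by move=> cf cg x; apply: continuous_comp; [exact: cf|exact: cg]. Qed.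

Section SubgroupTopology.
Variables (G : topologicalGroupType) (S : subgroup G).

Lemma subgroup_val_continuous : continuous (val : S -> G).
Proof. exact: (@initial_continuous (set_type (subgroup_set S)) G set_val). Qed.

Lemma continuous_to_subgroup {X : topologicalType} (f : X -> S) :
  continuous (val \o f : X -> G) -> continuous f.
Proof.
exact: (@continuous_comp_initial (set_type (subgroup_set S)) X G set_val).
Qed.

Lemma subgroup_mul_continuous : continuous (fun x : S * S => x.1 * x.2).
Proof.
apply: continuous_to_subgroup.
apply: (@continuous_compT _ _ _ (fun x : S * S => (val x.1, val x.2) : G * G)
  (fun x : G * G => x.1 * x.2)); last exact: mulg_continuous.
apply: continuous_pair; apply: continuous_compT subgroup_val_continuous.
  exact: continuous_fst.
exact: continuous_snd.
Qed.

Lemma subgroup_inv_continuous : continuous (fun x : S => x^-1).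
Proof.
apply: continuous_to_subgroup.
apply: (continuous_compT subgroup_val_continuous).
exact: (@invg_continuous G).
Qed.

HB.instance Definition _ := isTopologicalGroup.Build (subgroup_type S)
  subgroup_mul_continuous subgroup_inv_continuous.
End SubgroupTopology.

Definition top_isomorphic (G H : topologicalGroupType) : Prop :=
  exists (f : G -> H) (g : H -> G),
    [/\ {morph f : x y / x * y}, cancel f g, cancel g f,
        continuous f & continuous g].

Definition isomorphic_to_subgroup (G H : topologicalGroupType) : Prop :=
  exists S : subgroup H, top_isomorphic G S.

Definition TNA (G : topologicalGroupType) : Prop :=
  forall U : set G, nbhs 1 U ->
    exists S : subgroup G, open (subgroup_set S) /\ subgroup_set S `<=` U.

Definition abelian_group (G : groupType) : Prop :=
  forall x y : G, x * y = y * x.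

(** * Direct products and discrete groups *)

Definition direct_product {I : Type} (H : I -> Type) : Type := forall i, H i.

Section DirectProduct.
Variables (I : Type) (H : I -> groupType).
Local Notation P := (direct_product H).

HB.instance Definition _ := Choice.copy P (forall i, H i).

Let one : P := fun=> 1.
Let inv (x : P) : P := fun i => (x i)^-1.
Let mul (x y : P) : P := fun i => x i * y i.

Lemma direct_product_mulgA : associative mul.
Proof.
by move=> x y z; apply: functional_extensionality_dep => i; exact: mulgA.
Qed.
Lemma direct_product_mul1g : left_id one mul.
Proof.
by move=> x; apply: functional_extensionality_dep => i; exact: mul1g.
Qed.
Lemma direct_product_mulg1 : right_id one mul.
Proof.
by move=> x; apply: functional_extensionality_dep => i; exact: mulg1.
Qed.
Lemma direct_product_mulVg : left_inverse one inv mul.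
Proof.
by move=> x; apply: functional_extensionality_dep => i; exact: mulVg.
Qed.
Lemma direct_product_mulgV : right_inverse one inv mul.
Proof.
by move=> x; apply: functional_extensionality_dep => i; exact: mulgV.
Qed.

HB.instance Definition _ := isGroup.Build P direct_product_mulgA
  direct_product_mul1g direct_product_mulg1 direct_product_mulVg
  direct_product_mulgV.
End DirectProduct.

Section DirectProductTopology.
Variables (I : Type) (H : I -> topologicalGroupType).
Local Notation P := (direct_product H).

HB.instance Definition _ := Topological.copy P (prod_topology H).

Lemma direct_product_proj_continuous i : continuous (fun x : P => x i).
Proof. exact: (@proj_continuous {classic I} H i). Qed.

Lemma continuous_to_direct_product {X : topologicalType} (f : X -> P) :
  (forall i, continuous (fun x => f x i)) -> continuous f.
Proof.
move=> cf x; apply/cvg_sup => i.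
exact: (@continuous_comp_initial (forall i, H i) X (H i) (fun h => h i) f
  (cf i) x).
Qed.

Lemma direct_product_mul_continuous : continuous (fun x : P * P => x.1 * x.2).
Proof.
apply: continuous_to_direct_product => i.
apply: (@continuous_compT _ _ _ (fun x : P * P => (x.1 i, x.2 i) : H i * H i)
  (fun x : H i * H i => x.1 * x.2)); last exact: mulg_continuous.
apply: continuous_pair.
  exact: (@continuous_compT (P * P)%type P (H i) fst (fun x => x i)
    continuous_fst (@direct_product_proj_continuous i)).
exact: (@continuous_compT (P * P)%type P (H i) snd (fun x => x i)
  continuous_snd (@direct_product_proj_continuous i)).
Qed.

Lemma direct_product_inv_continuous : continuous (fun x : P => x^-1).
Proof.
apply: continuous_to_direct_product => i.
apply: (continuous_compT (@direct_product_proj_continuous i)).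
exact: (@invg_continuous (H i)).
Qed.

HB.instance Definition _ := isTopologicalGroup.Build P
  direct_product_mul_continuous direct_product_inv_continuous.
End DirectProductTopology.

Section DiscreteGroup.
Variable G : groupType.
Local Notation D := (discrete_topology G).

HB.instance Definition _ := Group.copy D G.

Lemma discrete_mul_continuous : continuous (fun x : D * D => x.1 * x.2).
Proof.
move=> [x y] U /nbhs_singleton Uxy.
exists ([set x], [set y]); first by split; exact: discrete_set1.
by move=> [a b] [/= -> ->].
Qed.

Lemma discrete_inv_continuous : continuous (fun x : D => x^-1).
Proof.
move=> x U /nbhs_singleton Ux; apply: (filterS _ (discrete_set1 (x : D))).
by move=> _ ->.
Qed.

HB.instance Definition _ := isTopologicalGroup.Build D
  discrete_mul_continuous discrete_inv_continuous.
End DiscreteGroup.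

(** * The groups Q, Z(p^oo) and their direct sums *)

Section DirectSum.
Variables (I : Type) (H : I -> groupType).

Definition finite_support : set (direct_product H) :=
  [set x | finite_set [set i | x i <> 1]].

Lemma finite_support_closed : group_closed [in finite_support].
Proof.
split.
  rewrite inE /= /finite_support /=.
  suff -> : [set i | (1 : direct_product H) i <> 1] = set0.
    exact: finite_set0.
  by rewrite -subset0 => i /=; exact.
move=> x y; rewrite !inE /finite_support /= => fx fy.
apply: (@sub_finite_set _ _ ([set i | x i <> 1] `|` [set i | y i <> 1])).
  move=> i /= xyi; apply: contrapT => /not_orP[/contrapT xi /contrapT yi].
  apply: xyi; change (x i * (y i)^-1 = 1).
  by rewrite xi yi mulgV.
by rewrite finite_setU.
Qed.

Definition direct_sum : subgroup (direct_product H) :=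
  Subgroup finite_support_closed.
End DirectSum.

Definition prime_number : Type := {p : nat | prime p}.

(* Z(p^oo) as the multiplicative group of complex p-power roots of unity. *)
Definition quasicyclic (p : prime_number) : Type :=
  set_type [set z : algC | exists n : nat, z ^+ (val p ^ n) = 1]%R.

Section Quasicyclic.
Variable p : prime_number.
Local Notation Zp := (quasicyclic p).
Local Notation roots := [set z : algC | exists n : nat, z ^+ (val p ^ n) = 1]%R.

HB.instance Definition _ := SubChoice.copy Zp (set_type roots).

Lemma quasicyclic_one_subproof : (1%R : algC) \in roots.
Proof. by rewrite inE; exists 0; rewrite GRing.expr1n. Qed.

Lemma quasicyclic_inv_subproof (x : Zp) : (val x)^-1%R \in roots.
Proof.
case: x => x /=; rewrite !inE => -[n xn].
by exists n; rewrite GRing.exprVn xn GRing.invr1.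
Qed.

Lemma quasicyclic_mul_subproof (x y : Zp) : (val x * val y)%R \in roots.
Proof.
case: x y => x + [y +] /=; rewrite !inE => -[n xn] [m ym].
exists (n + m)%N; rewrite GRing.exprMn expnD GRing.exprM xn GRing.expr1n.
by rewrite mulnC GRing.exprM ym GRing.expr1n GRing.mulr1.
Qed.

Let one : Zp := Sub 1%R quasicyclic_one_subproof.
Let inv (x : Zp) : Zp := Sub (val x)^-1%R (quasicyclic_inv_subproof x).
Let mul (x y : Zp) : Zp := Sub (val x * val y)%R (quasicyclic_mul_subproof x y).

Lemma quasicyclic_neq0 (x : Zp) : (val x != 0)%R.
Proof.
case: x => x /=; rewrite inE => -[n xn]; apply/eqP => x0.
have /prime_gt0 p0 := valP p.
move: xn; rewrite x0 GRing.expr0n expn_eq0 eqn0Ngt p0 /=.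
by move/eqP; rewrite eq_sym GRing.oner_eq0.
Qed.

Lemma quasicyclic_mulgA : associative mul.
Proof. by move=> x y z; apply: val_inj; rewrite !SubK GRing.mulrA. Qed.
Lemma quasicyclic_mul1g : left_id one mul.
Proof. by move=> x; apply: val_inj; rewrite !SubK GRing.mul1r. Qed.
Lemma quasicyclic_mulg1 : right_id one mul.
Proof. by move=> x; apply: val_inj; rewrite !SubK GRing.mulr1. Qed.
Lemma quasicyclic_mulVg : left_inverse one inv mul.
Proof.
by move=> x; apply: val_inj; rewrite !SubK GRing.mulVf // quasicyclic_neq0.
Qed.
Lemma quasicyclic_mulgV : right_inverse one inv mul.
Proof.
by move=> x; apply: val_inj; rewrite !SubK GRing.mulfV // quasicyclic_neq0.
Qed.

HB.instance Definition _ := isGroup.Build Zp quasicyclic_mulgA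
  quasicyclic_mul1g quasicyclic_mulg1 quasicyclic_mulVg quasicyclic_mulgV.
End Quasicyclic.

(* The additive group Q, written multiplicatively. *)
Definition rat_group : groupType := Algebra.to_multiplicative rat.

Definition divisible_sum (K : Type) : groupType :=
  (direct_sum (fun _ : K => rat_group) *
   direct_sum (fun p : prime_number =>
     direct_sum (fun _ : K => quasicyclic p)))%type.

(** * Symmetric groups *)

Definition bijections (Omega : Type) :
    set {ptws Omega -> discrete_topology {classic Omega}} :=
  [set f : {ptws Omega -> discrete_topology {classic Omega}} | bijective f].

(* The product is composition of functions. *)
Definition Sym (Omega : Type) : Type := set_type (@bijections Omega).

Section Sym.
Variable Omega : Type.
Local Notation S := (Sym Omega).
Local Notation D := (discrete_topology {classic Omega}).

HB.instance Definition _ := SubChoice.copy S (set_type (@bijections Omega)).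
HB.instance Definition _ := Topological.copy S (set_type (@bijections Omega)).

Definition sym_fun (s : S) : Omega -> Omega := val s.

Lemma sym_ext (s t : S) : sym_fun s =1 sym_fun t -> s = t.
Proof. by move=> st; apply: val_inj; apply: functional_extensionality_dep. Qed.

Lemma sym_bij (s : S) : bijective (sym_fun s).
Proof. exact: (set_mem (valP s)). Qed.

Lemma sym_inv_ex (s : S) :
  exists g : Omega -> Omega, cancel (sym_fun s) g /\ cancel g (sym_fun s).
Proof. by case: (sym_bij s) => g fg gf; exists g. Qed.

Definition sym_inv_fun (s : S) : Omega -> Omega := projT1 (cid (sym_inv_ex s)).

Lemma sym_funK s : cancel (sym_fun s) (sym_inv_fun s).
Proof. by have [] := projT2 (cid (sym_inv_ex s)). Qed.
Lemma sym_invK s : cancel (sym_inv_fun s) (sym_fun s).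
Proof. by have [] := projT2 (cid (sym_inv_ex s)). Qed.

Lemma sym_one_subproof : (id : {ptws Omega -> D}) \in @bijections Omega.
Proof. by rewrite inE; exists id. Qed.
Lemma sym_inv_subproof s :
  (sym_inv_fun s : {ptws Omega -> D}) \in @bijections Omega.
Proof.
by rewrite inE; exists (sym_fun s); [exact: sym_invK|exact: sym_funK].
Qed.
Lemma sym_mul_subproof s t :
  (sym_fun s \o sym_fun t : {ptws Omega -> D}) \in @bijections Omega.
Proof. by rewrite inE; apply: bij_comp; exact: sym_bij. Qed.

Let one : S := Sub (id : {ptws Omega -> D}) sym_one_subproof.
Let inv s : S :=
  Sub (sym_inv_fun s : {ptws Omega -> D}) (sym_inv_subproof s).
Let mul s t : S :=
  Sub (sym_fun s \o sym_fun t : {ptws Omega -> D}) (sym_mul_subproof s t).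

Lemma sym_mulgA : associative mul.
Proof. by move=> x y z; apply: sym_ext. Qed.
Lemma sym_mul1g : left_id one mul.
Proof. by move=> x; apply: sym_ext. Qed.
Lemma sym_mulg1 : right_id one mul.
Proof. by move=> x; apply: sym_ext. Qed.
Lemma sym_mulVg : left_inverse one inv mul.
Proof. by move=> x; apply: sym_ext => i; exact: sym_funK. Qed.
Lemma sym_mulgV : right_inverse one inv mul.
Proof. by move=> x; apply: sym_ext => i; exact: sym_invK. Qed.

HB.instance Definition _ :=
  isGroup.Build S sym_mulgA sym_mul1g sym_mulg1 sym_mulVg sym_mulgV.

Lemma sym_eval_nbhs (s : S) (i : Omega) :
  nbhs s [set t | sym_fun t i = sym_fun s i].
Proof.
have c : continuous (fun t : S => sym_fun t i : D).
  apply: (@continuous_compT S {ptws Omega -> D} D val (fun f => f i)).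
    exact: (@initial_continuous S {ptws Omega -> D} val).
  exact: (@proj_continuous {classic Omega} (fun=> D) i).
exact: (c s _ (discrete_set1 (sym_fun s i : D))).
Qed.

Lemma continuous_to_sym {X : topologicalType} (f : X -> S) :
  (forall x i, nbhs x [set y | sym_fun (f y) i = sym_fun (f x) i]) ->
  continuous f.
Proof.
move=> cf; apply: (@continuous_comp_initial S X {ptws Omega -> D} val f) => x.
apply/cvg_sup => i.
have ci : continuous (fun y => sym_fun (f y) i : D).
  move=> {}x U /nbhs_singleton Ux; apply: (filterS _ (cf x i)) => y /= fy.
  by rewrite /= fy.
exact: (@continuous_comp_initial {ptws Omega -> D}
  X D (fun h => h i) (fun y => val (f y)) ci x).
Qed.

Lemma sym_mul_continuous : continuous (fun x : S * S => x.1 * x.2).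
Proof.
apply: continuous_to_sym => -[s t] i.
exists ([set u | sym_fun u (sym_fun t i) = sym_fun s (sym_fun t i)],
        [set u | sym_fun u i = sym_fun t i]).
  by split; exact: sym_eval_nbhs.
by move=> [u v] [/= us vt]; rewrite /sym_fun /= -!/(sym_fun _) vt us.
Qed.

Lemma sym_inv_continuous : continuous (fun x : S => x^-1).
Proof.
apply: continuous_to_sym => s i.
apply: filterS (sym_eval_nbhs s (sym_inv_fun s i)) => t /=.
rewrite sym_invK => ti; change (sym_inv_fun t i = sym_inv_fun s i).
by rewrite -[in LHS]ti sym_funK.
Qed.

HB.instance Definition _ := isTopologicalGroup.Build S
  sym_mul_continuous sym_inv_continuous.
End Sym.

(* Main.v *)
From HB Require Import structures.
Require Import Defs.
From mathcomp Require Import all_boot all_algebra all_field.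
From mathcomp Require Import all_classical topology.

Set Implicit Arguments.
Unset Strict Implicit.
Unset Printing Implicit Defensive.

Local Open Scope classical_set_scope.
Local Open Scope card_scope.

(** Neighbourhoods in Sym(Omega), and in a product of discrete groups, are
    governed by finitely many discrete coordinates. In both cases the elements
    that agree with 1 on given coordinates form a subgroup, so these groups and
    their subgroups are TNA ([pointwise_TNA]); and if there are at most K
    coordinates with at most K values each, the finite sets of conditions
    [coordinate i = value a] give a base of size at most K
    ([pointwise_weight]). The weight bounds the cellularity and the character
    in every space.

    Conversely, in a TNA group with character at most K the neutral element has
    at most K open subgroups S_i as a local base, and the cosets of each S_i
    form a disjoint open family, hence are at most as many as the cellularity.
    The cosets themselves are discrete coordinates which determine the topology
    ([subgroup_base_coset]) and, in a Hausdorff group, the points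
    ([subgroup_base_separated]). Letting G act by translation on the union of
    all the G/S_i, a set of size at most K * K = K, embeds G into Sym(K)
    ([subgroup_base_sym]). If G is abelian the coordinates G -> G/S_i are
    homomorphisms and embed G into a product of at most K discrete groups of
    size at most K ([subgroup_base_product]).

    It remains to put one group in place of all the factors, i.e. to embed an
    abelian group B of size at most K into the direct sum D of K copies of Q
    and of each Z(p^oo) ([abelian_embedding_divisible_sum]). The usual route
    goes through the divisible hull and the structure of divisible groups.
    Here a single application of Zorn's lemma does both: coordinates of D are
    labelled by elements of B, and one takes a maximal injective homomorphism
    from a subgroup of B to D that uses only labels lying in its domain. An
    element x outside of the domain then always has its own unused label,
    which leaves room for extending the homomorphism
    ([maximal_partial_embedding]).

    The cardinal arithmetic rests on K * K = K ([infinite_square]). *)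

(** * Arithmetic of infinite cardinals *)

Lemma card_le_injP {T K : Type} (A : set T) (k0 : K) :
  A #<= [set: K] <-> exists f : T -> K, {in A &, injective f}.
Proof.
pose P : pointedType := HB.pack K (gen_eqMixin K) (gen_choiceMixin K)
  (isPointed.Build K k0).
by split=> /(@pcard_injP T P A).
Qed.

Lemma card_leTP {T K : Type} (k0 : K) :
  [set: T] #<= [set: K] <-> exists f : T -> K, injective f.
Proof.
rewrite (card_le_injP _ k0); split=> -[f fi]; exists f.
  by move=> x y; apply: fi; rewrite inE.
by move=> x y _ _; exact: fi.
Qed.

Lemma card_le_set_inj {T U : Type} (A : set T) (B : set U) :
  B !=set0 -> A #<= B ->
  exists2 f : T -> U, (forall x, B (f x)) & {in A &, injective f}.
Proof.
move=> [b Bb] AB; have : A #<= [set: B].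
  by rewrite (card_le_eqr (card_setT B)).
move=> /(card_le_injP _ (SigSub (mem_set Bb) : B))[f f_inj].
exists (fun x => val (f x)); first by move=> x; exact: set_valP.
by move=> x y Ax Ay /val_inj; exact: f_inj.
Qed.

Lemma infinite_inhabited {K : Type} :
  infinite_set [set: K] -> exists k : K, True.
Proof. by case/infinite_setN0 => k _; exists k. Qed.

(** The maximal graph of an injection from X * X to X, for X included in K. If X
    is no larger than its complement, the latter contains a disjoint copy Y of X,
    and the three products that X * Y, Y * X and Y * Y add can be sent into Y,
    since (X * X) * (X * X) injects into X; this contradicts maximality. So K is
    the union of X and of a set no larger than X, and K * K injects into X. *)
Lemma infinite_square {K : Type} : infinite_set [set: K] ->
  exists pi : K * K -> K, injective pi.
Proof.
move=> Kinf; have [k0 _] := infinite_inhabited Kinf.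
have /infiniteP/(card_leTP k0)[i i_inj] := Kinf.
pose dom (G : set (K * K * K)) := [set x | exists z, G (x, x, z)].
pose G0 := [set g : K * K * K | exists m n : nat,
  g = (i m, i n, i (choice.pickle (m, n)))].
(* The last clause, vacuous for the empty graph, makes every nonempty graph
   extend the countable G0 while being preserved by unions of all chains. *)
pose ok (G : set (K * K * K)) :=
  [/\ forall p z z', G (p, z) -> G (p, z') -> z = z',
  forall p q z, G (p, z) -> G (q, z) -> p = q,
  forall x y, dom G x -> dom G y -> exists z, G (x, y, z),
  forall x y z, G (x, y, z) -> [/\ dom G x, dom G y & dom G z] &
  forall g, G g -> G0 `<=` G].
have [G [[Gfun Ginj Gtot Gdom GG0] Gmax]] :
    exists G, ok G /\ forall H, G `<` H -> ~ ok H.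
  apply: Zorn_bigcup => C Cok Ctot.
  have both X Y : C X -> C Y -> exists Z, [/\ C Z, X `<=` Z & Y `<=` Z].
    by move=> CX CY; have [XY|YX] := Ctot _ _ CX CY; [exists Y|exists X]; split.
  split.
  - move=> p z z' [X CX Xz] [Y CY Yz]; have [Z [CZ XZ YZ]] := both _ _ CX CY.
    by have [+ _ _ _ _] := Cok _ CZ; apply; [exact: XZ Xz|exact: YZ].
  - move=> p q z [X CX Xz] [Y CY Yz]; have [Z [CZ XZ YZ]] := both _ _ CX CY.
    by have [_ + _ _ _] := Cok _ CZ; apply; [exact: XZ Xz|exact: YZ].
  - move=> x y [z [X CX Xz]] [t [Y CY Yt]].
    have [Z [CZ XZ YZ]] := both _ _ CX CY.
    have [_ _ + _ _] := Cok _ CZ => /(_ x y)[||u Zu].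
    + by exists z; exact: XZ.
    + by exists t; exact: YZ.
    + by exists u, Z.
  - move=> x y z [X CX Xz].
    have [_ _ _ /(_ _ _ _ Xz)[[a ?] [b ?] [c ?]] _] := Cok _ CX.
    by split; [exists a|exists b|exists c]; exists X.
  - move=> g [X CX Xg] h G0h; exists X => //.
    by have [_ _ _ _ /(_ _ Xg)] := Cok _ CX; apply.
have G0ok : ok G0.
  split.
  - by move=> p z z' [m [n [-> ->]]] [m' [n' [/i_inj -> /i_inj -> ->]]].
  - move=> p q z [m [n [-> ->]]] [m' [n' [-> /i_inj]]].
    by move/(pcan_inj choice.pickleK) => [-> ->].
  - move=> x y [z [m [_ [-> _ _]]]] [t [n [_ [-> _ _]]]].
    by eexists; exists m, n.
  - move=> x y z [m [n [-> -> ->]]].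
    by split; eexists; do 2!eexists; reflexivity.
  - by move=> g _ h.
have {}GG0 : G0 `<=` G.
  have [G00|/set0P[g Gg]] := eqVneq G set0; last exact: GG0 Gg.
  exfalso; apply: Gmax G0ok; rewrite G00; split=> //.
  by move=> /(_ (i 0, i 0, i (choice.pickle (0, 0)))); apply; exists 0, 0.
pose X := dom G.
have [f fG] : {f : K * K -> K | forall x y, X x -> X y -> G (x, y, f (x, y))}.
  apply: cid; have /choice[f fP] : forall p : K * K, exists z,
    X p.1 -> X p.2 -> G (p, z).
    move=> [x y]; have [Xx|nXx] := pselect (X x); last by exists k0.
    have [Xy|nXy] := pselect (X y); last by exists k0.
    by have [z] := Gtot _ _ Xx Xy; exists z.
  by exists f => x y Xx Xy; exact: fP.
have fX x y : X x -> X y -> X (f (x, y)).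
  by move=> Xx Xy; have [] := Gdom _ _ _ (fG _ _ Xx Xy).
have finj x y x' y' : X x -> X y -> X x' -> X y' -> f (x, y) = f (x', y') ->
    x = x' /\ y = y'.
  move=> Xx Xy Xx' Xy' e; have := fG _ _ Xx Xy; rewrite e => h.
  by have [-> ->] := Ginj _ _ _ h (fG _ _ Xx' Xy').
have Xi n : X (i n) by eexists; apply: GG0; exists n, n.
pose tag (b : bool) := i b.
have tagi : injective tag by move=> [] [] // /i_inj.
have [XcX|XXc] := card_le_total (~` X) X.
  have [h hX hi] : exists2 h : K -> K, (forall x, X (h x)) &
      {in ~` X &, injective h}.
    by apply: card_le_set_inj XcX; exists (i 0).
  pose r x := f (if `[< X x >] then x else h x, tag `[< X x >]).
  have Xr x : X (r x).
    by rewrite /r; case: asboolP => Xx; apply: fX => //; exact: Xi.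
  have rinj : injective r.
    have Xs x : X (if `[< X x >] then x else h x) by case: asboolP.
    move=> x y /finj[]; try exact: Xi; try exact: Xs.
    move=> + /tagi; case: asboolP => Xx; case: asboolP => Xy // e _.
    by apply: hi; rewrite ?inE.
  exists (fun p => f (r p.1, r p.2)) => -[x y] [x' y'] /=.
  by move=> /finj[]// /rinj -> /rinj ->.
have [h hX hi] : exists2 h : K -> K, (forall x, ~ X (h x)) &
    {in X &, injective h}.
  apply: card_le_set_inj (XXc); apply/set0P/eqP => Xc0.
  by move: XXc; rewrite Xc0 card_le0 => /eqP X0; have := Xi 0; rewrite X0.
pose Y := h @` X; pose Z := X `|` Y.
have [b [bX bh]] : exists b : K -> K, (forall z, Z z -> X (b z)) /\
    (forall z, Z z -> z = if `[< X z >] then b z else h (b z)).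
  have /choice[b bP] : forall z, exists x, Z z ->
      X x /\ z = if `[< X z >] then x else h x.
    move=> z; have [Zz|nZz] := pselect (Z z); last by exists z.
    case: asboolP => Xz; first by exists z.
    by case: Zz => // -[x Xx <-]; exists x.
  by exists b; split=> z /bP[].
pose r z := f (b z, tag `[< X z >]).
have Xr z : Z z -> X (r z) by move=> Zz; apply: fX; [exact: bX|exact: Xi].
have rinj : {in Z &, injective r}.
  move=> x y /set_mem Zx /set_mem Zy /finj[]; try exact: Xi; try exact: bX.
  by move=> e /tagi t; rewrite (bh _ Zx) (bh _ Zy) t e.
pose G' := G `|` [set g | [/\ Z g.1.1, Z g.1.2, ~ (X g.1.1 /\ X g.1.2) &
  g.2 = h (f (r g.1.1, r g.1.2))]].
have GZ x y z : G' (x, y, z) -> [/\ Z x, Z y & Z z].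
  move=> [/Gdom[? ? ?]|[/= Zx Zy _ ->]]; first by split; left.
  by split=> //; right; exists (f (r x, r y)) => //; apply: fX; exact: Xr.
have domG' z : dom G' z <-> Z z.
  split; first by move=> [u /GZ[]].
  move=> Zz; have [Xz|nXz] := pselect (X z).
    by exists (f (z, z)); left; exact: fG.
  by exists (h (f (r z, r z))); right; split=> // -[].
exfalso; apply: (Gmax G').
  split; first by move=> g; left.
  have Zh : Z (h (i 0)) by right; exists (i 0) => //; exact: Xi.
  move=> sub; have /sub/Gdom[/hX//] :
    G' (h (i 0), h (i 0), h (f (r (h (i 0)), r (h (i 0))))).
  by right; split=> //= -[/hX].
split.
- move=> [x y] z z' [Gz|[/= Zx Zy nXX ->]] [Gz'|[/= Zx' Zy' nXX' ->]] //.
  + exact: Gfun Gz Gz'.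
  + by case: nXX'; have [] := Gdom _ _ _ Gz.
  + by case: nXX; have [] := Gdom _ _ _ Gz'.
- have key p z q : G (p, z) -> [/\ Z q.1, Z q.2, ~ (X q.1 /\ X q.2) &
      z = h (f (r q.1, r q.2))] -> False.
    move: p => [x y] /Gdom[_ _ Xz] [Zx Zy _ e]; move: Xz; rewrite e; exact: hX.
  move=> p q z [Gz|Hz] [Gz'|Hz']; first exact: Ginj Gz Gz'.
  + by case: (key _ _ _ Gz Hz').
  + by case: (key _ _ _ Gz' Hz).
  + case: p q Hz Hz' => [x y] [x' y'] /= [Zx Zy _ ->] [Zx' Zy' _].
    have [rx ry rx' ry'] := And4 (Xr _ Zx) (Xr _ Zy) (Xr _ Zx') (Xr _ Zy').
    move/hi; rewrite !inE => /(_ (fX _ _ rx ry) (fX _ _ rx' ry'))/finj[] //.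
    move=> /(rinj _ _ (mem_set Zx) (mem_set Zx')) ->.
    by move=> /(rinj _ _ (mem_set Zy) (mem_set Zy')) ->.
- move=> x y /domG' Zx /domG' Zy; have [[Xx Xy]|nXX] := pselect (X x /\ X y).
    by exists (f (x, y)); left; exact: fG.
  by exists (h (f (r x, r y))); right.
- by move=> x y z /GZ[? ? ?]; split; apply/domG'.
- by move=> _ _ g /GG0; left.
Qed.

Section InfiniteCardinal.
Context {K : Type}.
Context (Kinf : infinite_set [set: K]).

Lemma card_le_prod {T U : Type} : [set: T] #<= [set: K] ->
  [set: U] #<= [set: K] -> [set: T * U] #<= [set: K].
Proof.
have [k0 _] := infinite_inhabited Kinf.
have [pi pi_inj] := infinite_square Kinf.
move=> /(card_leTP k0)[f fi] /(card_leTP k0)[g gi]; apply/(card_leTP k0).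
by exists (fun p => pi (f p.1, g p.2)) => -[x y] [x' y'] /pi_inj[/fi -> /gi ->].
Qed.

Lemma card_le_countType (T : countType) : [set: T] #<= [set: K].
Proof.
apply: card_le_trans (countableP [set: T]) _; exact/infiniteP.
Qed.

Lemma card_le_injT {T U : Type} (f : T -> U) : injective f ->
  [set: U] #<= [set: K] -> [set: T] #<= [set: K].
Proof.
have [k0 _] := infinite_inhabited Kinf.
move=> fi /(card_leTP k0)[g gi]; apply/(card_leTP k0).
by exists (g \o f); exact: inj_comp.
Qed.

Lemma card_le_seq {T : Type} : [set: T] #<= [set: K] ->
  [set: seq T] #<= [set: K].
Proof.
have [k0 _] := infinite_inhabited Kinf.
have [pi pi_inj] := infinite_square Kinf.
have /infiniteP/(card_leTP k0)[n n_inj] := Kinf.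
move=> /(card_leTP k0)[f fi]; apply/(card_leTP k0).
(* The length is recorded so that codes of different lengths cannot collide. *)
pose code := foldr (fun x k => pi (f x, k)) k0.
exists (fun s => pi (n (size s), code s)) => s t /pi_inj[/n_inj + +].
elim: s t => [|x s IHs] [|y t] //= [st] /pi_inj[/fi -> cst].
by rewrite (IHs t).
Qed.

Lemma card_le_bigcup {I T : Type} (A : set I) (F : I -> set T) :
  A #<= [set: K] -> (forall i, A i -> F i #<= [set: K]) ->
  \bigcup_(i in A) F i #<= [set: K].
Proof.
have [k0 _] := infinite_inhabited Kinf.
have [pi pi_inj] := infinite_square Kinf.
move=> /(card_le_injP _ k0)[f fi] AF.
have /choice[g gi] : forall i, exists g : T -> K,
    A i -> {in F i &, injective g}.
  move=> i; have [/AF/(card_le_injP _ k0)[g gi]|nAi] := pselect (A i).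
    by exists g.
  by exists (fun=> k0).
have /choice[j jP] : forall x, exists k, forall i, A i -> F i x ->
    exists2 i, A i /\ F i x & k = pi (f i, g i x).
  move=> x; have [[i [Ai Fix]]|no] := pselect (exists i, A i /\ F i x).
    by exists (pi (f i, g i x)) => _ _ _; exists i.
  by exists k0 => i Ai Fix; case: no; exists i.
apply/(card_le_injP _ k0); exists j.
move=> x y /set_mem[i Ai Fix] /set_mem[i' Ai' Fiy].
have [{Ai Fix}i [Ai Fix] ->] := jP x _ Ai Fix.
have [{Ai' Fiy}i' [Ai' Fiy] ->] := jP y _ Ai' Fiy.
move=> /pi_inj[/fi]; rewrite !inE => /(_ Ai Ai') ii'; move: Fiy; rewrite -ii'.
by move=> Fiy /(gi _ Ai); rewrite !inE; apply.
Qed.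

Lemma card_le_setU {T : Type} (A B : set T) : A #<= [set: K] ->
  B #<= [set: K] -> A `|` B #<= [set: K].
Proof.
move=> AK BK; rewrite -bigcup2E; apply: card_le_bigcup.
  exact: card_le_countType.
by move=> [|[|i]].
Qed.

Lemma card_le_add_aleph0 {T : Type} (A : set T) :
  A #<= [set: K] -> add_aleph0 A #<= [set: K].
Proof.
move=> AK; have -> : add_aleph0 A = inl @` A `|` inr @` setT.
  apply/seteqP; split=> [[a Aa|n _]|_ [[a Aa <-]|[n _ <-]]] //=.
    by left; exists a.
  by right; exists n.
apply: card_le_setU; apply: card_le_trans (card_image_le _ _) _ => //.
exact: card_le_countType.
Qed.

Lemma card_le_add_aleph0P {T : Type} (A : set T) :
  add_aleph0 A #<= [set: K] <-> A #<= [set: K].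
Proof.
split; last exact: card_le_add_aleph0.
have inlA : @inl T nat @` A #= A by apply: inj_card_eq => x y _ _ [].
rewrite -(card_le_eql inlA); apply: card_le_trans.
by apply: subset_card_le => _ [a Aa <-].
Qed.

End InfiniteCardinal.

Local Open Scope group_scope.

(** * Topologies of pointwise convergence *)

Definition agree_on {I X : Type} {H : I -> Type} (c : forall i, X -> H i)
    (J : set I) (x : X) : set X :=
  [set y | forall i, J i -> c i y = c i x].

(** The initial topology of maps to discrete spaces, stated through
    neighbourhoods: this is the form in which it passes to subspaces, and it
    covers products of discrete groups as well as symmetric groups, whose
    coordinates s |-> s i are not homomorphisms. *)
Definition pointwise_topology {I : Type} {X : topologicalType} {H : I -> Type}
    (c : forall i, X -> H i) : Prop :=
  forall x U, nbhs x U <-> exists2 J, finite_set J & agree_on c J x `<=` U.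

Definition topological_embedding {X Y : topologicalType} (f : X -> Y) : Prop :=
  forall x U, nbhs x U <-> exists2 V, nbhs (f x) V & f @^-1` V `<=` U.

Lemma agree_on_nbhs {I : Type} {X : topologicalType} {H : I -> Type}
    (c : forall i, X -> H i) (J : set I) (x : X) :
  pointwise_topology c -> finite_set J -> nbhs x (agree_on c J x).
Proof. by move=> pc Jfin; apply/pc; exists J. Qed.

Lemma agree_on_open {I : Type} {X : topologicalType} {H : I -> Type}
    (c : forall i, X -> H i) (J : set I) (x : X) :
  pointwise_topology c -> finite_set J -> open (agree_on c J x).
Proof.
move=> pc Jfin; rewrite openE => y yx; apply/pc; exists J => // z zy i Ji.
by rewrite zy // yx.
Qed.

(** For a group with known coordinates, this reduces the topological half of
    being isomorphic to a subgroup to a statement about G alone. *)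
Lemma pointwise_embeddingP {I : Type} {X Y : topologicalType} {H : I -> Type}
    (c : forall i, Y -> H i) (f : X -> Y) : pointwise_topology c ->
  topological_embedding f <-> pointwise_topology (fun i x => c i (f x)).
Proof.
move=> pc; split=> fE x U.
  rewrite fE; split=> [[V /pc[J Jfin JV] VU]|[J Jfin JU]].
    by exists J => // y yx; apply: VU; exact: JV.
  by exists (agree_on c J (f x)) => //; exact: agree_on_nbhs.
rewrite fE; split=> [[J Jfin JU]|[V /pc[J Jfin JV] VU]].
  by exists (agree_on c J (f x)) => //; exact: agree_on_nbhs.
by exists J => // y yx; apply: VU; exact: JV.
Qed.

Lemma filter_forall_finite {T I : Type} (F : set_system T) {FF : Filter F}
    (J : set I) (P : I -> set T) :
  finite_set J -> (forall i, J i -> F (P i)) ->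
  F [set t | forall i, J i -> P i t].
Proof.
move=> /(@finite_fsetP {classic I})[L ->] FP.
apply: filterS (@filter_bigI T {classic I} L P F FF _) => [t Pt i iL|i iL].
  exact: Pt.
exact: FP.
Qed.

(** New coordinates still define the topology if they are locally constant,
    and fine enough to determine each of the old ones. *)
Lemma pointwise_refine {X : topologicalType} {I J : Type} {H : I -> Type}
    {H' : J -> Type} (c : forall i, X -> H i) (c' : forall j, X -> H' j) :
  pointwise_topology c ->
  (forall j x, nbhs x [set y | c' j y = c' j x]) ->
  (forall i, exists j, forall x y, c' j x = c' j y -> c i x = c i y) ->
  pointwise_topology c'.
Proof.
move=> pc c'loc /choice[r rP] x U; split=> [/pc[L Lfin LU]|[L Lfin LU]].
  exists (r @` L); first exact: finite_image.
  by move=> y yx; apply: LU => i Li; apply: rP; apply: yx; exists i.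
apply: (filterS LU).
apply: (filter_forall_finite (F := nbhs x)
  (P := fun j y => c' j y = c' j x)) => // j _.
exact: c'loc.
Qed.

(** The filter generated by the sets [agree_on _ J x], J finite, converges to x,
    because a filter converges in a product as soon as all of its projections
    do; so every neighbourhood of x contains one of these sets. *)
Lemma prod_pointwise {I : Type} (T : I -> topologicalType) :
  (forall i (x : T i), nbhs x [set x]) ->
  @pointwise_topology I (prod_topology T) T (fun i x => x i).
Proof.
move=> Tdisc x U; split; last first.
  case=> J Jfin JU; apply: (filterS (F := nbhs (x : prod_topology T)) JU).
  apply: (filter_forall_finite (F := nbhs (x : prod_topology T))
    (P := fun i y => y i = x i)) => // i _.
  have := @proj_continuous {classic I} T i x [set x i] (Tdisc i _).
  exact.
pose F := filter_from [set J : set I | finite_set J]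
  (fun J => agree_on (fun i (y : prod_topology T) => y i) J x).
have FF : Filter F.
  apply: filter_from_filter; first by exists set0; exact: finite_set0.
  move=> J L Jfin Lfin; exists (J `|` L); first by rewrite /= finite_setU.
  by move=> y yx; split=> i ?; apply: yx; [left|right].
suff Fx : F --> x by move=> /Fx[J Jfin JU]; exists J.
apply/cvg_sup => i V [W [[B oB <-] /= Bx WV]].
exists [set i]; first exact: finite_set1.
by move=> y yx; apply: WV; rewrite /= (yx i erefl).
Qed.

Lemma set_type_embedding {X : topologicalType} (S : set X) :
  topological_embedding (set_val : set_type S -> X).
Proof.
move=> x U; split.
  move=> [_ [[B oB <-] /= Bx BU]]; exists B => //.
  by apply: open_nbhs_nbhs.
case=> V xV VU; apply: (filterS VU).
exact: (@initial_continuous (set_type S) X set_val).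
Qed.

Lemma topological_embedding_continuous {X Y : topologicalType} (f : X -> Y) :
  topological_embedding f -> continuous f.
Proof. by move=> fE x V xV; apply/fE; exists V. Qed.

Lemma morph_mulg1 {G H : groupType} (f : G -> H) :
  {morph f : x y / x * y} -> f 1 = 1.
Proof. by move=> fM; apply: (mulgI (f 1)); rewrite -fM !mulg1. Qed.

Lemma morph_mulgV {G H : groupType} (f : G -> H) :
  {morph f : x y / x * y} -> {morph f : x / x^-1}.
Proof.
by move=> fM x; apply: (mulgI (f x)); rewrite -fM !mulgV (morph_mulg1 fM).
Qed.

Lemma isomorphic_to_subgroupP (G H : topologicalGroupType) :
  isomorphic_to_subgroup G H <->
  exists f : G -> H, [/\ {morph f : x y / x * y}, injective f &
                          topological_embedding f].
Proof.
split=> [[S [f [g [fM fK gK fc gc]]]]|[f [fM f_inj fE]]].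
  exists (fun x => val (f x)); split.
  - by move=> x y; rewrite fM valM.
  - by move=> x y /val_inj /(can_inj fK).
  - have valE : topological_embedding (val : S -> H).
      exact: (@set_type_embedding H (subgroup_set S)).
    move=> x U; split=> [xU|[V xV VU]]; last first.
      apply: (filterS VU); apply: (fc x (val @^-1` V)).
      by apply/valE; exists V.
    have /valE[V fxV VU] : nbhs (f x) (g @^-1` U) by apply: gc; rewrite fK.
    by exists V => // y /VU; rewrite /= fK.
have rg : group_closed [in range f].
  split; first by rewrite inE -(morph_mulg1 fM); exists 1.
  move=> x y; rewrite !inE => -[a _ <-] [b _ <-].
  by rewrite -morph_mulgV// -fM; exists (a / b).
pose S := Subgroup rg.
have fS x : f x \in range f by rewrite inE; exists x.
pose F x : S := SigSub (fS x).
have /choice[g gK] : forall s : S, exists x, F x = s.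
  case=> s s_in; have := set_mem s_in; case=> x _ fx.
  by exists x; apply: val_inj.
have FK : cancel F g by move=> x; apply: f_inj; apply: (congr1 val (gK (F x))).
exists S, F, g; split=> //.
- by move=> x y; apply: val_inj; rewrite valM -fM.
- apply: continuous_to_subgroup; exact: topological_embedding_continuous.
- move=> s U /fE[V]; rewrite -[f (g s)]/(val (F (g s))) gK => sV VU.
  have : nbhs s (val @^-1` V) := subgroup_val_continuous sV.
  apply: filterS => t tV; apply: VU.
  by rewrite /= -[f (g t)]/(val (F (g t))) gK.
Qed.

Lemma direct_product_pointwise {I : Type} (H : I -> groupType) :
  @pointwise_topology I (direct_product (fun i => discrete_topology (H i))) H
    (fun i x => x i).
Proof.
exact: (@prod_pointwise I (fun i => discrete_topology (H i))
  (fun i x => discrete_set1 x)).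
Qed.

Lemma sym_pointwise (Omega : Type) :
  @pointwise_topology Omega (Sym Omega) (fun=> Omega) (fun i s => sym_fun s i).
Proof.
have valE : topological_embedding
    (val : Sym Omega -> {ptws Omega -> discrete_topology {classic Omega}}).
  exact: (@set_type_embedding _ (@bijections Omega)).
refine (iffLR (@pointwise_embeddingP Omega (Sym Omega)
  {ptws Omega -> discrete_topology {classic Omega}} (fun=> Omega)
  (fun i h => h i) val _) valE).
exact: (@prod_pointwise Omega (fun=> discrete_topology {classic Omega})
  (fun i x => discrete_set1 x)).
Qed.

(** The condition on c says that the stabilizer of each coordinate is a
    subgroup; it is all that coordinates of permutations and of products have
    in common. *)
Lemma pointwise_TNA (G : topologicalGroupType) {I : Type} {H : I -> Type}
    (c : forall i, G -> H i) : pointwise_topology c ->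
  (forall i x y, c i x = c i 1 -> c i y = c i 1 -> c i (x / y) = c i 1) ->
  TNA G.
Proof.
move=> pc cM U /pc[J Jfin JU].
have JG : group_closed [in agree_on c J 1].
  split; first by rewrite inE.
  by move=> x y; rewrite !inE => xJ yJ i Ji; apply: cM; [exact: xJ|exact: yJ].
exists (Subgroup JG); split=> //=; exact: agree_on_open.
Qed.

Lemma weight_leP {X : topologicalType} {K : Type} : infinite_set [set: K] ->
  weight X #<= [set: K] <-> exists2 B, @basis X B & B #<= [set: K].
Proof.
move=> Kinf; rewrite (card_le_add_aleph0P Kinf).
have [|Bb Bmin] := @min_cardP _ [set B | @basis X B].
  exists open; split=> // x U /=; rewrite nbhsE => -[V [oV Vx] VU].
  by exists V.
split=> [le|[B /Bmin/card_le_trans]]; last exact.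
by exists (min_card [set B | @basis X B]).
Qed.

Lemma pointwise_weight {X : topologicalType} {I T K : Type}
    (c : I -> X -> T) : infinite_set [set: K] ->
  [set: I] #<= [set: K] -> [set: T] #<= [set: K] ->
  pointwise_topology c -> weight X #<= [set: K].
Proof.
move=> Kinf IK TK pc; apply/(weight_leP Kinf).
(* A list of pairs (i, a) stands for the conditions c i y = a; such lists are
   enough for a base, and there are at most K of them. *)
pose U := foldr (fun (p : I * T) V => [set y | c p.1 y = p.2] `&` V) setT.
exists (range U); last first.
  apply: card_le_trans (card_image_le _ _) _.
  by apply: card_le_seq => //; exact: card_le_prod.
split=> [_ [s _ <-]|x V /pc[J /(@finite_seqP {classic I})[t ->] JV]].
  elim: s => [|[i a] s IHs] /=; first exact: openT.
  apply: openI IHs; rewrite openE => y /= ya; apply/pc; exists [set i].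
    exact: finite_set1.
  by move=> z /(_ i erefl) /= ->.
have Ut s y : U [seq (i, c i x) | i <- s] y <->
    forall i, i \in (s : seq {classic I}) -> c i y = c i x.
  elim: s => [|i s IHs] /=; first by split.
  split=> [[yi /IHs ys] j|ys].
    by rewrite inE => /orP[/eqP ->|/ys].
  split; first by apply: ys; rewrite mem_head.
  by apply/IHs => j js; apply: ys; rewrite inE js orbT.
exists (U [seq (i, c i x) | i <- t]).
  by split; [exists [seq (i, c i x) | i <- t]|apply/Ut].
by move=> y /Ut yt; exact: JV.
Qed.

(** * Weight, cellularity and character *)

Lemma cellularity_leP {X : topologicalType} {K : Type} :
  infinite_set [set: K] -> cellularity X #<= [set: K] <->
  forall V, @disjoint_open_family X V -> V #<= [set: K].
Proof.
by move=> Kinf; rewrite (card_le_add_aleph0P Kinf) sup_card_leP.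
Qed.

Lemma local_base_open_nbhs {X : topologicalType} (p : X) :
  local_base p (open_nbhs p).
Proof. by split=> // U /=; rewrite nbhsE => -[V pV VU]; exists V. Qed.

Lemma character_leP {X : topologicalType} {K : Type} :
  infinite_set [set: K] -> character X #<= [set: K] <->
  forall p : X, exists2 V, local_base p V & V #<= [set: K].
Proof.
move=> Kinf; rewrite (card_le_add_aleph0P Kinf) sup_card_leP.
have cP (p : X) : local_base p (character_at p) /\
    forall V, local_base p V -> character_at p #<= V.
  have base : [set V | @local_base X p V] !=set0.
    by exists (open_nbhs p); exact: local_base_open_nbhs.
  exact: min_cardP base.
split=> [XK p|XK _ [p _ <-]].
  exists (character_at p); first by case: (cP p).
  by apply: XK; exists p.
have [V pV VK] := XK p; have [_ le] := cP p.
exact: card_le_trans (le _ pV) VK.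
Qed.

Lemma weight_cellularity {X : topologicalType} {K : Type} :
  infinite_set [set: K] -> weight X #<= [set: K] ->
  cellularity X #<= [set: K].
Proof.
move=> Kinf /(weight_leP Kinf)[B [Bo Bb] BK].
apply/(cellularity_leP Kinf) => V [Vo Vd].
have /choice[b bP] : forall U : set X, exists W, V U -> U <> set0 ->
    [/\ B W, W <> set0 & W `<=` U].
  move=> U; have [[VU /eqP/set0P[x Ux]]|no] := pselect (V U /\ U <> set0).
    have [W [BW Wx] WU] : filter_from [set W | B W /\ W x] id U.
      by apply: (Bb x); apply: open_nbhs_nbhs; split=> //; exact: Vo.
    by exists W => _ _; split=> // W0; move: Wx; rewrite W0.
  by exists set0 => VU U0; case: no.
(* Choosing a basic open set inside of each member of V is injective except on
   the empty set, which may belong to V. *)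
have -> : V = (V `\ set0) `|` (V `&` [set set0]).
  apply/seteqP; split=> [U VU|U [[]//|[]//]].
  by have [U0|U0] := pselect (U = set0); [right|left].
apply: card_le_setU => //; last first.
  apply: card_le_trans (subset_card_le (@subIsetr _ _ _)) _.
  rewrite (card_le_eql (eq_card1 set0 0)).
  by apply: card_le_trans (card_le_countType Kinf nat); exact: subset_card_le.
apply: card_le_trans BK.
have binj : {in V `\ set0 &, injective b}.
  move=> U U' /set_mem[VU U0] /set_mem[VU' U0'] e.
  have [_ /eqP/set0P[x Wx] WU] := bP _ VU U0; have [_ _ WU'] := bP _ VU' U0'.
  apply: (Vd _ _ VU VU'); exists x; split; first exact: WU.
  by apply: WU'; rewrite -e.
rewrite -(card_le_eql (inj_card_eq binj)); apply: subset_card_le.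
by move=> _ [U [VU U0] <-]; have [] := bP _ VU U0.
Qed.

Lemma weight_character {X : topologicalType} {K : Type} :
  infinite_set [set: K] -> weight X #<= [set: K] ->
  character X #<= [set: K].
Proof.
move=> Kinf /(weight_leP Kinf)[B [Bo Bb] BK].
apply/(character_leP Kinf) => p; exists [set U | B U /\ U p].
  by split; [move=> U [BU Up]; split=> //; exact: Bo|exact: Bb].
by apply: card_le_trans BK; apply: subset_card_le => U [].
Qed.

(** * Open subgroups and their cosets *)

Definition subgroup_base {G : topologicalGroupType} {I : Type}
    (S : I -> subgroup G) : Prop :=
  (forall i, open (subgroup_set (S i))) /\
  (forall U : set G, nbhs 1 U -> exists i, subgroup_set (S i) `<=` U).

(** Indexing the subgroups by a given local base keeps their number under
    control. *)
Lemma TNA_subgroup_base {G : topologicalGroupType} (V : set (set G)) :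
  TNA G -> local_base 1 V -> exists S : V -> subgroup G, subgroup_base S.
Proof.
move=> GT [Vo Vb].
have /choice[S SP] : forall U : V, exists S : subgroup G,
    open (subgroup_set S) /\ subgroup_set S `<=` val U.
  move=> [U UV]; apply: GT; have [oU U1] := Vo _ (set_mem UV).
  exact: open_nbhs_nbhs.
exists S; split=> [U|U /Vb[W VW WU]]; first by case: (SP U).
exists (SigSub (mem_set VW)); have [_ SW] := SP (SigSub (mem_set VW)).
exact: subset_trans SW WU.
Qed.

Section Cosets.
Context {G : topologicalGroupType}.
Implicit Types (S : subgroup G) (x y : G).

Lemma subgroup_set1 S : subgroup_set S 1.
Proof. by have [] := subgroup_closed S; rewrite inE. Qed.

Lemma subgroup_set_div S x y :
  subgroup_set S x -> subgroup_set S y -> subgroup_set S (x / y).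
Proof.
have [_ Sd] := subgroup_closed S.
by have := Sd x y; rewrite !inE => h /h; apply.
Qed.

Lemma subgroup_setV S x : subgroup_set S x -> subgroup_set S x^-1.
Proof.
by rewrite -[x^-1]mul1g; apply: subgroup_set_div; exact: subgroup_set1.
Qed.

Lemma subgroup_setM S x y :
  subgroup_set S x -> subgroup_set S y -> subgroup_set S (x * y).
Proof.
move=> Sx Sy; rewrite -[y]invgK; apply: subgroup_set_div => //.
exact: subgroup_setV.
Qed.

Definition coset S x : set G := [set y | subgroup_set S (x^-1 * y)].

Lemma coset_eqP S x y : coset S x = coset S y <-> subgroup_set S (x^-1 * y).
Proof.
split=> [e|Sxy].
  have : coset S y y by rewrite /coset /= mulVg; exact: subgroup_set1.
  by rewrite -e.
apply/seteqP; split=> z; rewrite /coset /= => Sz.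
  have -> : y^-1 * z = (x^-1 * y)^-1 * (x^-1 * z).
    by rewrite invgM invgK mulgA mulgK.
  by apply: subgroup_setM => //; exact: subgroup_setV.
have -> : x^-1 * z = (x^-1 * y) * (y^-1 * z) by rewrite mulgA mulgK.
exact: subgroup_setM.
Qed.

Lemma mul_continuous2 (a b : G) : continuous (fun x => a * x * b).
Proof.
have mc (f g : G -> G) : continuous f -> continuous g ->
    continuous (fun x => f x * g x).
  move=> fc gc; apply: (@continuous_compT _ _ _ (fun x => (f x, g x))
    (fun x : G * G => x.1 * x.2)); last exact: mulg_continuous.
  exact: continuous_pair.
have cc (c : G) : continuous (fun _ : G => c) by move=> x; exact: cvg_cst.
by apply: (mc) => //; apply: mc => // x.
Qed.

Lemma mul_nbhs (a b x : G) (U : set G) :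
  nbhs (a * x * b) U -> nbhs x [set y | U (a * y * b)].
Proof. exact: mul_continuous2. Qed.

Lemma coset_open S x : open (subgroup_set S) -> open (coset S x).
Proof.
rewrite !openE => So y Sy.
have := @mul_nbhs x^-1 1 y (subgroup_set S); rewrite mulg1 => /(_ (So _ Sy)).
by apply: filterS => z; rewrite /= mulg1.
Qed.

Lemma coset_nbhs S x :
  open (subgroup_set S) -> nbhs x [set y | coset S y = coset S x].
Proof.
move=> So; have : nbhs x (coset S x).
  apply: open_nbhs_nbhs; split; first exact: coset_open.
  by rewrite /coset /= mulVg; exact: subgroup_set1.
by apply: filterS => y xy; symmetry; apply/coset_eqP.
Qed.

(** The cosets of an open subgroup are open and pairwise disjoint. *)
Lemma card_cosets S {K : Type} : infinite_set [set: K] ->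
  open (subgroup_set S) -> cellularity G #<= [set: K] ->
  range (coset S) #<= [set: K].
Proof.
move=> Kinf So /(cellularity_leP Kinf); apply; split.
  by move=> _ [x _ <-]; exact: coset_open.
move=> _ _ [x _ <-] [y _ <-] [z [xz yz]].
by rewrite (coset_eqP S x z).2 // (coset_eqP S y z).2.
Qed.

End Cosets.

Lemma hausdorff_separated {G : topologicalGroupType} : hausdorff_space G ->
  forall x : G, (forall U, nbhs 1 U -> U x) -> x = 1.
Proof.
move=> GH x x1; symmetry; apply: GH => U V U1 Vx.
exists x; split; first exact: x1.
exact: nbhs_singleton.
Qed.

Lemma subgroup_base_coset {G : topologicalGroupType} {I : Type}
    (S : I -> subgroup G) :
  subgroup_base S -> pointwise_topology (fun i => coset (S i)).
Proof.
case=> So Ssub x U; split=> [xU|[L Lfin LU]]; last first.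
  apply: (filterS LU); apply: (filter_forall_finite (F := nbhs x)
    (P := fun i y => coset (S i) y = coset (S i) x)) => // i _.
  exact: coset_nbhs.
have [|i SiU] := Ssub [set y | U (x * y * 1)].
  by apply: mul_nbhs; rewrite !mulg1.
exists [set i]; first exact: finite_set1.
by move=> y /(_ i erefl)/esym/coset_eqP/SiU /=; rewrite mulVKg mulg1.
Qed.

Lemma subgroup_base_separated {G : topologicalGroupType} {I : Type}
    (S : I -> subgroup G) : hausdorff_space G -> subgroup_base S ->
  forall x y, (forall i, coset (S i) x = coset (S i) y) -> x = y.
Proof.
move=> GH [_ Ssub] x y xy; apply: (mulgI x^-1); rewrite mulVg; symmetry.
by apply: hausdorff_separated => // U /Ssub[i]; apply; exact/coset_eqP.
Qed.

(** * The action on cosets *)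

(** An action on a subset Om of T, carried to a set K that contains a copy of
    Om; the rest of K is fixed. Working with a subset of K rather than with a
    bijection onto it avoids comparing sizes exactly. *)
Lemma action_to_sym {G : groupType} {T K : Type} (Om : set T)
    (a : G -> T -> T) (e : T -> K) :
  {in Om &, injective e} -> (forall g t, Om t -> Om (a g t)) ->
  (forall t, Om t -> a 1 t = t) ->
  (forall g h t, Om t -> a (g * h) t = a g (a h t)) ->
  exists f : G -> Sym K, [/\ {morph f : x y / x * y},
    forall g t, Om t -> sym_fun (f g) (e t) = e (a g t) &
    forall g k, ~ (e @` Om) k -> sym_fun (f g) k = k].
Proof.
move=> e_inj aOm a1 aM.
have /choice[p pP] : forall gk : G * K, exists k,
    (forall t, Om t -> e t = gk.2 -> k = e (a gk.1 t)) /\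
    (~ (e @` Om) gk.2 -> k = gk.2).
  move=> [g k]; have [[t Ot tk]|no] := pselect ((e @` Om) k); last first.
    by exists k; split=> // t Ot tk; case: no; exists t.
  exists (e (a g t)); split=> [u Ou uk|[]]; last by exists t.
  by congr (e (a g _)); apply: e_inj; rewrite ?inE// uk.
have pe g t : Om t -> p (g, e t) = e (a g t).
  by move=> Ot; have [+ _] := pP (g, e t); apply.
have pid g k : ~ (e @` Om) k -> p (g, k) = k by case: (pP (g, k)).
have p1 k : p (1, k) = k.
  have [[t Ot <-]|/pid//] := pselect ((e @` Om) k).
  by rewrite pe// a1.
have pM g h k : p (g * h, k) = p (g, p (h, k)).
  have [[t Ot <-]|nk] := pselect ((e @` Om) k); last by rewrite !pid.
  by rewrite !pe ?aM//; exact: aOm.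
have pb g : (fun k => p (g, k)) \in @bijections K.
  rewrite inE; exists (fun k => p (g^-1, k)) => k; rewrite -pM.
    by rewrite mulVg.
  by rewrite mulgV.
exists (fun g => SigSub (pb g)).
split=> [g h|g t Ot|g k nk]; [|exact: pe|exact: pid].
by apply: sym_ext => k; exact: pM.
Qed.

(** The action of G by left translation on the cosets of all the S i, seen as
    subsets of G so that no disjoint union of the quotients is needed. The
    stabilizer of S i as a coset is S i as a subgroup, hence the action is at least as
    fine as the coordinates [coset (S i)]; and each translate of a fixed coset
    is locally constant in the group element. *)
Lemma subgroup_base_sym {G : topologicalGroupType} {I K : Type}
    (S : I -> subgroup G) (e : set G -> K) :
  hausdorff_space G -> subgroup_base S ->
  {in \bigcup_i range (coset (S i)) &, injective e} ->
  isomorphic_to_subgroup G (Sym K).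
Proof.
move=> GH Sb e_inj; have So := Sb.1; set Om := \bigcup_i _ in e_inj.
pose a (g : G) (C : set G) : set G := [set y | C (g^-1 * y)].
have aS g i x : a g (coset (S i) x) = coset (S i) (g * x).
  by apply/seteqP; split=> y; rewrite /a /coset /= invgM mulgA.
have OmS i x : Om (coset (S i) x) by exists i => //; exists x.
have [f [fM fe fid]] : exists f : G -> Sym K, [/\ {morph f : x y / x * y},
    forall g C, Om C -> sym_fun (f g) (e C) = e (a g C) &
    forall g k, ~ (e @` Om) k -> sym_fun (f g) k = k].
  apply: action_to_sym e_inj _ _ _.
  - by move=> g _ [i _ [x _ <-]]; rewrite aS.
  - by move=> _ [i _ [x _ <-]]; rewrite aS mul1g.
  - by move=> g h _ [i _ [x _ <-]]; rewrite !aS mulgA.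
have sep i : exists k, forall x y : G, sym_fun (f x) k = sym_fun (f y) k ->
    coset (S i) x = coset (S i) y.
  exists (e (coset (S i) 1)) => x y; rewrite !fe// !aS !mulg1.
  by apply: e_inj; rewrite inE.
have loc k (x : G) : nbhs x [set y | sym_fun (f y) k = sym_fun (f x) k].
  have [[_ [i _ [b _ <-]] <-]|nk] := pselect ((e @` Om) k); last first.
    by apply: nearW => y; rewrite /= !fid.
  have : nbhs x [set y | coset (S i) (1 * y * b) = coset (S i) (1 * x * b)].
    apply: (mul_nbhs (U := [set y | coset (S i) y = _])).
    exact: coset_nbhs.
  by apply: filterS => y /=; rewrite !mul1g !fe// !aS => ->.
apply/isomorphic_to_subgroupP; exists f; split=> //.
  move=> x y fxy; apply: (subgroup_base_separated GH Sb) => i.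
  by have [k] := sep i; apply; rewrite fxy.
apply/(pointwise_embeddingP f (@sym_pointwise K)).
exact: pointwise_refine (subgroup_base_coset Sb) loc sep.
Qed.

(** * Products of discrete quotients *)

(** Q is the set of cosets, with operations computed on representatives. *)
Lemma abelian_quotient {A : topologicalGroupType} (S : subgroup A) :
  abelian_group A -> exists (Q : groupType) (q : A -> Q),
  [/\ {morph q : x y / x * y},
      forall x y, q x = q y <-> coset S x = coset S y &
      [set: Q] #<= range (coset S)].
Proof.
move=> Aab; pose T : choiceType := set_type (range (coset S)).
pose q x : T := SigSub (mem_set (imageT (coset S) x)).
have qC x y : q x = q y <-> coset S x = coset S y.
  by split=> [[]|xy]; [|exact: val_inj].
have qE x y : q x = q y <-> subgroup_set S (x^-1 * y) by rewrite qC coset_eqP.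
have /choice[r rK] : forall t : T, exists x, q x = t.
  move=> [C C_in]; have := set_mem C_in; case=> x _ xC.
  by exists x; apply: val_inj.
pose mul s t := q (r s * r t); pose inv t := q (r t)^-1.
have qM x y : mul (q x) (q y) = q (x * y).
  have /qE rx := rK (q x); have /qE ry := rK (q y).
  apply/qE; have -> : (r (q x) * r (q y))^-1 * (x * y) =
      (r (q x))^-1 * x * ((r (q y))^-1 * y).
    by rewrite (Aab (r (q y))^-1 y) invgM -mulgA (Aab (r (q y))^-1) !mulgA.
  exact: subgroup_setM.
have qV x : inv (q x) = q x^-1.
  have /qE rx := rK (q x); apply/qE; rewrite invgK Aab.
  by rewrite -[r (q x)]invgK -invgM; exact: subgroup_setV.
have mulA : associative mul.
  by move=> x y z; rewrite -[x]rK -[y]rK -[z]rK !qM mulgA.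
have mul1 : left_id (q 1) mul by move=> x; rewrite -[x]rK qM mul1g.
have mulr1 : right_id (q 1) mul by move=> x; rewrite -[x]rK qM mulg1.
have mulV : left_inverse (q 1) inv mul.
  by move=> x; rewrite -[x]rK qV qM mulVg.
have mulrV : right_inverse (q 1) inv mul.
  by move=> x; rewrite -[x]rK qV qM mulgV.
pose Q : groupType := HB.pack T (isGroup.Build T mulA mul1 mulr1 mulV mulrV).
exists Q, q; split=> //.
by have /card_eqPle[] := card_setT (range (coset S)).
Qed.

Lemma product_subgroupP (G : topologicalGroupType) {I : Type}
    (H : I -> groupType) :
  isomorphic_to_subgroup G
    (direct_product (fun i => discrete_topology (H i))) <->
  exists c : forall i, G -> H i,
    [/\ forall i, {morph c i : x y / x * y}, pointwise_topology c &
        forall x y, (forall i, c i x = c i y) -> x = y].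
Proof.
split=> [/isomorphic_to_subgroupP[f [fM f_inj fE]]|[c [cM cp c_inj]]].
  exists (fun i x => f x i); split.
  - by move=> i x y; rewrite fM.
  - exact/(pointwise_embeddingP f (@direct_product_pointwise I H)).
  - by move=> x y xy; apply: f_inj; apply: functional_extensionality_dep.
apply/isomorphic_to_subgroupP.
pose f x : direct_product (fun i => discrete_topology (H i)) := fun i => c i x.
exists f; split=> [x y|x y xy|].
- by apply: functional_extensionality_dep => i; exact: cM.
- by apply: c_inj => i; exact: (congr1 (fun h => h i) xy).
- exact/(pointwise_embeddingP f (@direct_product_pointwise I H)).
Qed.

(** The quotient maps by the S i are locally constant homomorphisms that
    determine the cosets. *)
Lemma subgroup_base_product {A : topologicalGroupType} {I : Type}
    (S : I -> subgroup A) : hausdorff_space A -> abelian_group A ->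
  subgroup_base S -> exists H : I -> groupType,
    (forall i, [set: H i] #<= range (coset (S i))) /\
    isomorphic_to_subgroup A
    (direct_product (fun i => discrete_topology (H i))).
Proof.
move=> AH Aab Sb.
have /choice[H HP] : forall i, exists Q : groupType, exists q : A -> Q,
    [/\ {morph q : x y / x * y},
        forall x y, q x = q y <-> coset (S i) x = coset (S i) y &
        [set: Q] #<= range (coset (S i))].
  by move=> i; exact: abelian_quotient.
exists H; split=> [i|]; first by have [q []] := HP i.
pose q i := sval (cid (HP i)).
have qP i := svalP (cid (HP i)).
have qE i x y : q i x = q i y <-> coset (S i) x = coset (S i) y.
  by have [_ + _] := qP i; apply.
apply/product_subgroupP; exists q; split.
- by move=> i; have [] := qP i.
- apply: (pointwise_refine (subgroup_base_coset Sb)) => [i x|i].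
    by apply: filterS (coset_nbhs x (Sb.1 i)) => y /qE.
  by exists i => x y /qE.
- by move=> x y xy; apply: (subgroup_base_separated AH Sb) => i; exact/qE.
Qed.

(** * Embedding an abelian group into a divisible one *)

Lemma abelian_mulgACA {G : groupType} : abelian_group G ->
  forall x y z t : G, (x * y) * (z * t) = (x * z) * (y * t).
Proof. by move=> Gab x y z t; rewrite -!mulgA (mulgA y) (Gab y z) !mulgA. Qed.

Lemma abelian_mulgF {G : groupType} : abelian_group G ->
  forall x y z t : G, (x * y) / (z * t) = (x / z) * (y / t).
Proof.
by move=> Gab x y z t; rewrite invgM (Gab t^-1) (abelian_mulgACA Gab).
Qed.

(** D is an abelian group with a notion of support, a set of labels in K for
    each element; e labels the elements of B. Apart from being divisible
    without enlarging supports, D should contain at each label an element of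
    infinite order, and one of each prime order, that keep their label when
    raised to any nontrivial power. *)
Section DivisibleExtension.
Context {B D : groupType} {K : Type} (supp : D -> set K) (e : B -> K).
Context (Bab : abelian_group B) (Dab : abelian_group D)
  (e_inj : injective e).
Context (supp1 : supp 1 = set0)
  (suppF : forall x y, supp (x / y) `<=` supp x `|` supp y).

Let suppV x : supp x^-1 `<=` supp x.
Proof. by move=> k; rewrite -[x^-1]mul1g => /suppF; rewrite supp1 => -[]. Qed.

Let suppM x y : supp (x * y) `<=` supp x `|` supp y.
Proof.
move=> k; rewrite -[y in x * y]invgK => /suppF[]; first by left.
by move=> /suppV; right.
Qed.

Let suppX x n : supp (x ^+ n) `<=` supp x.
Proof.
elim: n => [|n IHn] k; first by rewrite expg0 supp1.
by rewrite expgS => /suppM[//|/IHn].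
Qed.

Let BDab (r s : B * D) : r * s = s * r.
Proof. by case: r s => [b y] [b' y']; congr (_, _). Qed.

(** The graph of an injective homomorphism from a subgroup of B to D whose
    values are supported by labels of elements of the domain. Graphs are used
    because all these clauses pass to unions of chains, including the empty
    graph as the union of the empty chain. *)
Definition partial_embedding (R : set (B * D)) : Prop :=
  [/\ forall r s, R r -> R s -> R (r / s),
      forall r, R r -> r.1 = 1 <-> r.2 = 1 &
      forall r, R r -> supp r.2 `<=` e @` (fst @` R)].

Lemma partial_embedding1 R r : partial_embedding R -> R r -> R 1.
Proof. by case=> RF _ _ Rr; rewrite -(mulgV r); exact: RF. Qed.

Lemma partial_embeddingV R r : partial_embedding R -> R r -> R r^-1.
Proof.
move=> Re Rr; rewrite -[r^-1]mul1g; case: (Re) => RF _ _; apply: RF => //.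
exact: partial_embedding1 Rr.
Qed.

Lemma partial_embeddingM R r s :
  partial_embedding R -> R r -> R s -> R (r * s).
Proof.
move=> Re Rr Rs; rewrite -[s]invgK; case: (Re) => RF _ _; apply: RF => //.
exact: partial_embeddingV.
Qed.

Lemma partial_embeddingX R r n : partial_embedding R -> R r -> R (r ^+ n).
Proof.
move=> Re Rr; elim: n => [|n IHn]; first exact: partial_embedding1 Rr.
by rewrite expgS; exact: partial_embeddingM.
Qed.

(** The quotients of g ^+ n by g ^+ m are the powers of g with integer
    exponents. *)
Definition adjoin (R : set (B * D)) (g : B * D) : set (B * D) :=
  [set w | exists2 r, R r & exists n m, w = r * (g ^+ n / g ^+ m)].

(** For each power g ^+ n = (x ^+ n, d ^+ n), either the value d ^+ n at x ^+ n
    is already imposed by R, or x ^+ n is new and d ^+ n is not the inverse of a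
    value. Then x ^+ n and d ^+ n become trivial modulo R at the same time, so
    the extension stays both well defined and injective. Negative powers follow
    by taking inverses. *)
Lemma partial_embedding_adjoin R (g : B * D) : partial_embedding R -> R 1 ->
  supp g.2 `<=` e @` (g.1 |` fst @` R) ->
  (forall n, R (g ^+ n) \/
     ~ (fst @` R) (g ^+ n).1 /\ forall r, R r -> (r * g ^+ n).2 <> 1) ->
  partial_embedding (adjoin R g).
Proof.
move=> Re R1 gsupp gR; have [RF RE Rsupp] := Re.
have Ag : adjoin R g g.
  by exists 1 => //; exists 1%N, 0%N; rewrite expg1 expg0 divg1 mul1g.
have AR : R `<=` adjoin R g.
  by move=> r Rr; exists r => //; exists 0%N, 0%N; rewrite mulgV mulg1.
have cond r n : R r -> (r * g ^+ n).1 = 1 <-> (r * g ^+ n).2 = 1.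
  move=> Rr; have [Rg|[ng nr]] := gR n.
    by apply: RE; exact: partial_embeddingM.
  split=> [rg|/(nr _ Rr)//]; case: ng; exists r^-1.
    exact: partial_embeddingV.
  by apply: (mulgI r.1); rewrite -[RHS]/((r * g ^+ n).1) rg; exact: mulgV.
split.
- move=> _ _ [r Rr [n [m ->]]] [s Rs [k [l ->]]].
  exists (r / s); first exact: RF.
  exists (n + l)%N, (m + k)%N.
  rewrite (abelian_mulgF BDab) invgF; congr (_ * _).
  by rewrite !expgnDr (abelian_mulgF BDab) -[in RHS](invgF (g ^+ k)) invgF.
- move=> _ [r Rr [n [m ->]]]; have [mn|/ltnW nm] := leqP m n.
    by rewrite -expgnFr//; exact: cond.
  rewrite -[r in r * _]invgK -invgF -expgnFr// BDab -invgM.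
  have := cond _ (m - n)%N (partial_embeddingV Re Rr).
  case: (r^-1 * g ^+ (m - n)) => [b y] /= byE.
  by split=> /eqP; rewrite invg_eq1 => /eqP/byE ->; rewrite invg1.
- have dom : e @` (g.1 |` fst @` R) `<=` e @` (fst @` adjoin R g).
    apply: image_subset => _ [->|[r Rr <-]]; first by exists g.
    by exists r => //; exact: AR.
  move=> w [r Rr [n [m wE]]]; apply: subset_trans dom => k; rewrite wE.
  have gX i : (g ^+ i).2 = g.2 ^+ i.
    by elim: i => // i IHi; rewrite !expgS -IHi.
  move=> /suppM[/(Rsupp _ Rr)[b bR <-]|]; first by exists b => //; right.
  by move=> /suppF[]; rewrite -/snd gX => /suppX/gsupp.
Qed.

Context (supp_div : forall d p, prime p ->
  exists2 d', d' ^+ p = d & supp d' `<=` supp d).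
Context (supp_free : forall k, exists2 u, supp u `<=` [set k] &
  forall n, (0 < n)%N -> supp (u ^+ n) k).
Context (supp_tors : forall k p, prime p -> exists v,
  [/\ supp v `<=` [set k], v ^+ p = 1 &
      forall n, ~~ (p %| n) -> supp (v ^+ n) k]).

Let pairX (x : B) (d : D) n : ((x, d) : B * D) ^+ n = (x ^+ n, d ^+ n).
Proof. by elim: n => // n IHn; rewrite !expgS IHn. Qed.

(** Since p is prime, x is a product of powers of x ^+ p and x ^+ n. *)
Lemma partial_embedding_bezout R x p n : partial_embedding R -> prime p ->
  ~~ (p %| n) -> (fst @` R) (x ^+ p) -> (fst @` R) (x ^+ n) -> (fst @` R) x.
Proof.
move=> Re p_pr pn [r Rr rx] [s Rs sx].
have /(coprimeP _ (prime_gt0 p_pr))[[u v] /= uv] : coprime p n.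
  by rewrite prime_coprime.
exists (r ^+ u / s ^+ v).
  by case: (Re) => RF _ _; apply: RF; exact: partial_embeddingX.
case: r s rx sx {Rr Rs} => [b y] [b' y'] /= bx b'x; rewrite !pairX /=.
change (b ^+ u / b' ^+ v = x).
rewrite bx b'x -!expgnA mulnC (mulnC n) -expgnFr ?uv ?expg1//.
by apply: ltnW; rewrite -subn_gt0 uv.
Qed.

(** A maximal partial embedding is defined everywhere. Suppose that x is not in
    the domain. If some such x has prime order p, send it to an element of order
    p at the label of x. Otherwise, if a power of x lies in the domain, one may
    assume that x ^+ p does, p prime, and send x to a p-th root of the image of
    x ^+ p: a new relation would yield an element of order p outside of the
    domain, which is the excluded case. If no power of x lies in the domain,
    send x to an element of infinite order at the label of x. *)
Lemma maximal_partial_embedding :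
  exists2 R, partial_embedding R & forall x, (fst @` R) x.
Proof.
have [R [Re Rmax]] : exists R, partial_embedding R /\
    forall T, R `<` T -> ~ partial_embedding T.
  apply: Zorn_bigcup => C Ce Ctot; split.
  - move=> r s [X CX Xr] [Y CY Ys]; have [XY|YX] := Ctot _ _ CX CY.
      by exists Y => //; have [+ _ _] := Ce _ CY; apply=> //; exact: XY.
    by exists X => //; have [+ _ _] := Ce _ CX; apply=> //; exact: YX.
  - by move=> r [X CX Xr]; have [_ + _] := Ce _ CX; apply.
  - move=> r [X CX Xr] k kr.
    have [_ _ /(_ _ Xr _ kr)[_ [s Xs <-] <-]] := Ce _ CX.
    by exists s.1 => //; exists s => //; exists X.
have R1 : R 1.
  have [R0|/set0P[r]] := eqVneq R set0; last exact: partial_embedding1.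
  exfalso; apply: (Rmax [set 1]); first by rewrite R0; split=> // /(_ 1); apply.
  split=> [_ _ -> ->|_ ->|_ ->]; first exact: mulgV.
    by [].
  by rewrite /= supp1.
have dom1 : (fst @` R) 1 by exists 1.
have maximal x d : (fst @` R) x \/ ~ partial_embedding (adjoin R (x, d)).
  have [|nx] := pselect ((fst @` R) x); [by left|right].
  apply: Rmax; split.
    by move=> r Rr; exists r => //; exists 0%N, 0%N; rewrite mulgV mulg1.
  move=> sub; apply: nx; exists (x, d) => //; apply: sub.
  by exists 1 => //; exists 1%N, 0%N; rewrite expg1 expg0 divg1 mul1g.
(* The powers of x in the domain are those with exponent divisible by p, so
   that only the other exponents have to be checked. *)
have root x d p : prime p -> R (x ^+ p, d ^+ p) ->
    supp d `<=` e @` (x |` fst @` R) ->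
    (forall n r, R r -> ~~ (p %| n) -> ~ (fst @` R) x -> r.2 * d ^+ n <> 1) ->
    (fst @` R) x.
  move=> p_pr Rp dsupp dn; have [//|] := maximal x d.
  have [//|nx] := pselect ((fst @` R) x); case.
  apply: partial_embedding_adjoin => // n.
  have [/dvdnP[m ->]|pn] := boolP (p %| n).
    left; rewrite mulnC expgnA; apply: partial_embeddingX => //.
    by rewrite pairX.
  right; rewrite pairX; split=> [xn|r Rr]; last exact: dn.
  apply: nx; apply: (partial_embedding_bezout Re p_pr pn) => //.
  by exists (x ^+ p, d ^+ p).
exists R => // x0; apply: contrapT => nx0; have [RF RE Rsupp] := Re.
have suppE x v : supp v `<=` [set e x] -> supp v `<=` e @` (x |` fst @` R).
  by move=> vx k /vx ->; exists x => //; left.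
(* The support of r.2^-1 contains only labels of elements of the domain, and e
   is injective. *)
have fresh x v r : R r -> ~ (fst @` R) x -> supp v (e x) -> r.2 * v <> 1.
  move=> Rr nx vx rv; have : supp r.2 (e x).
    by apply: suppV; rewrite (mulg1_eq rv).
  by move=> /(Rsupp _ Rr)[b bR /e_inj bx]; apply: nx; rewrite -bx.
have [[x [p [nx p_pr xp]]]|notors] :=
    pselect (exists x p, [/\ ~ (fst @` R) x, prime p & x ^+ p = 1]).
  have [v [vx vp vn]] := supp_tors (e x) p_pr.
  apply/nx/(root x v p p_pr); [by rewrite xp vp|exact: suppE|].
  by move=> n r Rr pn _; apply: fresh nx _ => //; exact: vn.
have [[n n_gt0 x0n]|noroot] :=
    pselect (exists2 n, (0 < n)%N & (fst @` R) (x0 ^+ n)).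
  have /ex_minnP[{n_gt0 x0n}m /andP[m_gt0 /asboolP x0m] m_min] :
    exists n, (0 < n)%N && `[< (fst @` R) (x0 ^+ n) >].
    by exists n; rewrite n_gt0; exact/asboolP.
  have m_gt1 : (1 < m)%N.
    by case: m m_gt0 x0m {m_min} => // -[|//] _; rewrite expg1.
  have p_pr := pdiv_prime m_gt1; set p := pdiv m in p_pr.
  have mE : (m %/ p * p)%N = m by rewrite divnK// pdiv_dvd.
  have nx : ~ (fst @` R) (x0 ^+ (m %/ p)).
    move=> xR; have /m_min :
        (0 < m %/ p)%N && `[< (fst @` R) (x0 ^+ (m %/ p)) >].
      by rewrite divn_gt0 ?prime_gt0// dvdn_leq ?pdiv_dvd//; exact/asboolP.
    by rewrite leqNgt ltn_Pdiv// prime_gt1.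
  have [[b y] Rby /= bx] := x0m; have [d dp dsupp] := supp_div y p_pr.
  apply/nx/(root _ d p p_pr).
  - by rewrite -expgnA mE -bx dp.
  - by move=> k /dsupp/(Rsupp _ Rby)[c cR <-]; exists c => //; right.
  move=> {}n r Rr pn _ rd; set x := x0 ^+ _ in nx; pose t := r.1 * x ^+ n.
  have Rg : R (x ^+ p, d ^+ p) by rewrite /x -expgnA mE -bx dp.
  have tp : t ^+ p = 1.
    have : R ((t, r.2 * d ^+ n) ^+ p).
      have -> : (t, r.2 * d ^+ n) ^+ p = r ^+ p * (x ^+ p, d ^+ p) ^+ n.
        case: r @t {Rr rd} => b' y' /=.
        rewrite !pairX /= expgMn; last exact: Bab.
        rewrite expgMn; last exact: Dab.
        by rewrite -!expgnA (mulnC n).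
      by apply: partial_embeddingM => //; exact: partial_embeddingX.
    by rewrite pairX => /RE/= [_ +]; apply; rewrite rd expg1n.
  have [tR|nt] := pselect ((fst @` R) t); last by apply: notors; exists t, p.
  apply: nx; apply: (partial_embedding_bezout Re p_pr pn).
    by exists (x ^+ p, d ^+ p).
  have [s Rs st] := tR; exists (r^-1 * s).
    by apply: partial_embeddingM => //; exact: partial_embeddingV.
  change (r.1^-1 * s.1 = x ^+ n); by rewrite st mulKg.
have [u ux un] := supp_free (e x0).
have [//|] := maximal x0 u; case.
apply: partial_embedding_adjoin => //; first exact: suppE.
move=> [|n]; [by left|right]; rewrite pairX; split=> [xn|r Rr].
  by apply: noroot; exists n.+1.
by apply: fresh nx0 _ => //; exact: un.
Qed.

Lemma embedding_in_divisible : exists2 f : B -> D,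
  {morph f : x y / x * y} & injective f.
Proof.
have [R Re Rdom] := maximal_partial_embedding; have [RF RE Rsupp] := Re.
have /choice[f fR] : forall x, exists d, R (x, d).
  by move=> x; have [[b d] Rbd /= <-] := Rdom x; exists d.
have Rfun x y d : R (x, y) -> R (x, d) -> y = d.
  move=> xy xd; apply: divg1_eq; apply: (RE _ (RF _ _ xy xd)).1.
  exact: mulgV.
exists f => [x y|x y fxy].
  apply: Rfun (fR _) _; exact: (partial_embeddingM Re (fR x) (fR y)).
apply: divg1_eq; apply: (RE _ (RF _ _ (fR x) (fR y))).2.
by change (f x / f y = 1); rewrite fxy mulgV.
Qed.

End DivisibleExtension.

(** * Direct sums and quasicyclic groups *)

Section DirectSumTheory.
Context {I : Type} {H : I -> groupType}.
Implicit Types x y : direct_sum H.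

Definition entry (x : direct_sum H) (i : I) : H i := val x i.

Lemma entry_ext x y : (forall i, entry x i = entry y i) -> x = y.
Proof.
move=> xy; apply: val_inj; apply: functional_extensionality_dep => i.
exact: xy.
Qed.

Lemma entryM x y i : entry (x * y) i = entry x i * entry y i.
Proof. by []. Qed.

Lemma entryX x n i : entry (x ^+ n) i = entry x i ^+ n.
Proof. by elim: n => // n IHn; rewrite !expgS entryM IHn. Qed.

Lemma direct_sum_abelian :
  (forall i, abelian_group (H i)) -> abelian_group (direct_sum H).
Proof. by move=> Hab x y; apply: entry_ext => i; rewrite !entryM Hab. Qed.

Lemma direct_sum_of (f : forall i, H i) : finite_set [set i | f i <> 1] ->
  exists x, forall i, entry x i = f i.
Proof.
move=> ffin.
by exists (SigSub (mem_set ffin : f \in @Defs.finite_support I H)).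
Qed.

Lemma entry_finite x : finite_set [set i | entry x i <> 1].
Proof. exact: (set_mem (valP x)). Qed.

(** A choice made at each entry stays in the direct sum if it is trivial
    wherever the given entry is. *)
Lemma direct_sum_choice (R : forall i, H i -> H i -> Prop) :
  (forall i h, exists2 h', R i h h' & h = 1 -> h' = 1) ->
  forall x, exists y, forall i, R i (entry x i) (entry y i).
Proof.
move=> RP x.
have fP i : {h' | R i (entry x i) h' /\ (entry x i = 1 -> h' = 1)}.
  by apply: cid; have [h'] := RP i (entry x i); exists h'.
pose f i := sval (fP i).
have [|y yf] := @direct_sum_of f.
  apply: sub_finite_set (entry_finite x) => i fi xi; apply: fi.
  by rewrite /f; case: (fP i) => h' /= [_]; apply.
by exists y => i; rewrite yf /f; case: (fP i) => h' [].
Qed.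

Lemma direct_sum_single (i : I) (h : H i) :
  exists x, entry x i = h /\ forall j, j <> i -> entry x j = 1.
Proof.
pose f := @dfwith {classic I} H (fun=> 1) i h.
have fi : f i = h by exact: dfwithin.
have fj j : j <> i -> f j = 1.
  by move=> ji; apply: dfwithout; apply/eqP => ij; apply: ji.
have [|x xf] := @direct_sum_of f.
  apply: (@sub_finite_set _ _ [set i]) => [j|]; last exact: finite_set1.
  by move=> fj1; apply: contrapT => /fj.
by exists x; split=> [|j ji]; rewrite xf ?fi ?fj.
Qed.

(** An element is coded by the list of its nontrivial entries with their
    indices. *)
Lemma card_direct_sum {K : Type} : infinite_set [set: K] ->
  [set: I] #<= [set: K] -> (forall i, [set: H i] #<= [set: K]) ->
  [set: direct_sum H] #<= [set: K].
Proof.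
move=> Kinf IK HK; have [k0 _] := infinite_inhabited Kinf.
have fP i : {f : H i -> K | injective f}.
  by apply: cid; exact/(card_leTP k0).
pose f i := sval (fP i); have f_inj i : injective (f i) := svalP (fP i).
have [e e_inj] := (card_leTP k0).1 IK.
have /choice[s sP] : forall x, exists s : seq {classic I},
    [set i | entry x i <> 1] = [set` s].
  by move=> x; have /(@finite_seqP {classic I}) := entry_finite x.
pose code x : seq {classic K * K} := [seq (e i, f i (entry x i)) | i <- s x].
have code_sub x y : code x = code y -> forall i, entry x i <> 1 ->
    entry x i = entry y i.
  move=> xy i xi; have is_ : i \in s x by have : [set` s x] i by rewrite -sP.
  have mapI := @mapP {classic I} {classic K * K}
    (fun i => (e i, f i (entry _ i))).
  have : ((e i, f i (entry x i)) : {classic K * K}) \in code x.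
    by apply/mapI; exists i.
  by rewrite xy => /mapI[j _ [/e_inj <- /f_inj]].
apply: (card_le_injT Kinf (f := code)); last first.
  by apply: card_le_seq => //; apply: card_le_prod.
move=> x y xy; apply: entry_ext => i.
have [xi|/(code_sub _ _ xy)//] := pselect (entry x i = 1).
have [yi|/(code_sub _ _ (esym xy))//] := pselect (entry y i = 1).
by rewrite xi yi.
Qed.

End DirectSumTheory.

Section QuasicyclicTheory.
Variable q : prime_number.

Lemma quasicyclicX (z : quasicyclic q) n : val (z ^+ n) = (val z ^+ n)%R.
Proof. by elim: n => // n IHn; rewrite expgS GRing.exprS -IHn. Qed.

Lemma quasicyclic_abelian : abelian_group (quasicyclic q).
Proof. by move=> x y; apply: val_inj; exact: GRing.mulrC. Qed.

(** For p = q any p-th root of z in the complex numbers is again a q-power root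
    of unity; for p <> q raising to the power p is invertible on the roots of
    unity of order dividing q ^ n. *)
Lemma quasicyclic_root (p : nat) (z : quasicyclic q) : prime p ->
  exists y, y ^+ p = z.
Proof.
move=> p_pr; have [n zn] := set_mem (valP z).
have [pq|pq] := eqVneq p (val q).
  have [y yz] : exists y : algC, (y ^+ p)%R = val z.
    by eexists; exact: (Num.Theory.rootCK (prime_gt0 p_pr)).
  have y_in :
      y \in [set z : algC | exists n, (z ^+ (val q ^ n))%R = 1%R].
    by rewrite inE; exists n.+1; rewrite expnS -{1}pq GRing.exprM yz zn.
  exists (SigSub y_in : quasicyclic q); apply: val_inj.
  by rewrite quasicyclicX.
have q_gt0 : (0 < val q ^ n)%N by rewrite expn_gt0 prime_gt0 ?(valP q).
have : coprime p (val q ^ n).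
  rewrite coprimeXr// prime_coprime// dvdn_prime2 ?(valP q)//.
move=> /(coprimeP _ (prime_gt0 p_pr))[[u v] /= uv].
exists (z ^+ u); rewrite -expgnA; apply: val_inj; rewrite quasicyclicX.
have -> : (u * p = v * val q ^ n + 1)%N.
  by rewrite -uv subnKC// ltnW// -subn_gt0 uv.
by rewrite GRing.exprD mulnC GRing.exprM zn GRing.expr1n GRing.mul1r.
Qed.

Lemma quasicyclic_order : exists z : quasicyclic q,
  z ^+ val q = 1 /\ forall n, ~~ (val q %| n) -> z ^+ n <> 1.
Proof.
have [w wprim] := C_prim_root_exists (prime_gt0 (valP q)).
have w_in : w \in [set z : algC | exists n, (z ^+ (val q ^ n))%R = 1%R].
  by rewrite inE; exists 1%N; rewrite expn1; exact: prim_expr_order.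
exists (SigSub w_in : quasicyclic q); split=> [|n qn].
  by apply: val_inj; rewrite quasicyclicX /= (prim_expr_order wprim).
move=> /(congr1 val); rewrite quasicyclicX /= => wn.
by move: qn; rewrite (prim_order_dvd wprim) wn eqxx.
Qed.

End QuasicyclicTheory.

Lemma rat_groupX (r : rat_group) n : r ^+ n = ((r : rat) *+ n)%R :> rat.
Proof. by elim: n => // n IHn; rewrite expgS GRing.mulrS -IHn. Qed.

Section DivisibleSum.
Context {K : Type}.
Local Notation D := (divisible_sum K).

Definition rat_entry (d : D) (k : K) : rat_group := entry d.1 k.
Definition torsion_entry (d : D) (p : prime_number) (k : K) : quasicyclic p :=
  entry (entry d.2 p) k.

Lemma divisible_sumX (d : D) n : d ^+ n = (d.1 ^+ n, d.2 ^+ n).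
Proof. by elim: n => // n IHn; rewrite !expgS IHn. Qed.

Lemma rat_entryX d n k : rat_entry (d ^+ n) k = rat_entry d k ^+ n.
Proof. by rewrite divisible_sumX /rat_entry entryX. Qed.

Lemma torsion_entryX d n p k :
  torsion_entry (d ^+ n) p k = torsion_entry d p k ^+ n.
Proof. by rewrite divisible_sumX /torsion_entry !entryX. Qed.

Lemma torsion_entryF (x y : D) p k :
  torsion_entry (x / y) p k = torsion_entry x p k / torsion_entry y p k.
Proof. by []. Qed.

Lemma rat_entryF (x y : D) k :
  rat_entry (x / y) k = rat_entry x k / rat_entry y k.
Proof. by []. Qed.

Lemma divisible_sum_abelian : abelian_group D.
Proof.
move=> x y; congr pair; apply: direct_sum_abelian.
  by move=> _; exact: (@GRing.addrC rat).
by move=> p; apply: direct_sum_abelian => _; exact: quasicyclic_abelian.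
Qed.

(** The index k is shared by the copy number k of Q and of every Z(p^oo), so
    that one label gives access to elements of all orders. *)
Definition dsupp (d : D) : set K :=
  [set k | rat_entry d k <> 1 \/ exists p, torsion_entry d p k <> 1].

Lemma dsupp1 : dsupp 1 = set0.
Proof. by apply/seteqP; split=> // k [|[p]]; case. Qed.

Lemma dsuppF x y : dsupp (x / y) `<=` dsupp x `|` dsupp y.
Proof.
move=> k; apply: contraPP => /not_orP[].
move=> /not_orP[/contrapT xr /forallNP xt] /not_orP[/contrapT yr /forallNP yt].
apply/not_orP; split.
  by move=> xy; apply: xy; rewrite rat_entryF xr yr mulgV.
apply/forallNP => p xyp; apply: xyp.
have /contrapT xp := xt p; have /contrapT yp := yt p.
by rewrite torsion_entryF xp yp mulgV.
Qed.

Lemma dsupp_div d p : prime p ->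
  exists2 d', d' ^+ p = d & dsupp d' `<=` dsupp d.
Proof.
move=> p_pr.
have [a aP] : exists a, forall k, entry a k ^+ p = rat_entry d k /\
    (rat_entry d k = 1 -> entry a k = 1).
  apply: (@direct_sum_choice K (fun=> rat_group)
    (fun _ h h' => h' ^+ p = h /\ (h = 1 -> h' = 1))) => _ r.
  pose r' : rat_group := ((r : rat) / p%:R)%R.
  have r1 : r = 1 -> r' = 1 by rewrite /r' => ->; exact: GRing.mul0r.
  exists r' => //; split=> //; rewrite rat_groupX -[LHS]GRing.mulr_natr.
  by rewrite GRing.divfK// Num.Theory.pnatr_eq0 -lt0n prime_gt0.
have [b bP] : exists b : direct_sum (fun q : prime_number =>
      direct_sum (fun _ : K => quasicyclic q)),
    forall q k, entry (entry b q) k ^+ p = torsion_entry d q k /\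
      (torsion_entry d q k = 1 -> entry (entry b q) k = 1).
  apply: (@direct_sum_choice prime_number
    (fun q => direct_sum (fun _ : K => quasicyclic q))
    (fun q h h' => forall k, entry h' k ^+ p = entry h k /\
      (entry h k = 1 -> entry h' k = 1))) => q h.
  have [|h' hh'] := @direct_sum_choice K (fun=> quasicyclic q)
    (fun _ z y => y ^+ p = z /\ (z = 1 -> y = 1)) _ h.
    move=> _ z; have [->|z1] := pselect (z = 1).
      by exists 1; rewrite ?expg1n.
    by have [y yz] := quasicyclic_root z p_pr; exists y.
  exists h' => // h1; apply: entry_ext => k; have [_] := hh' k; apply.
  by rewrite h1.
exists (a, b).
  rewrite divisible_sumX [RHS]surjective_pairing; congr pair.
    by apply: entry_ext => k; rewrite entryX; case: (aP k).
  apply: entry_ext => q; apply: entry_ext => k.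
  by rewrite !entryX; case: (bP q k).
move=> k [ak|[q bk]].
  by left=> dk; apply: ak; case: (aP k) => _; apply.
by right; exists q => dk; apply: bk; case: (bP q k) => _; apply.
Qed.

Lemma dsupp_free k : exists2 u, dsupp u `<=` [set k] &
  forall n, (0 < n)%N -> dsupp (u ^+ n) k.
Proof.
have [a [ak a1]] := @direct_sum_single K (fun=> rat_group) k (1%R : rat).
exists (a, 1) => [j [aj|[p]]|n n_gt0]; last first.
- left; rewrite rat_entryX /rat_entry ak rat_groupX => /eqP.
  rewrite -[_ == _]/((1 *+ n : rat) == 0)%R Num.Theory.pnatr_eq0.
  by rewrite eqn0Ngt n_gt0.
- by case.
- by apply: contrapT => /a1.
Qed.

Lemma dsupp_tors k p : prime p -> exists v : D,
  [/\ dsupp v `<=` [set k], v ^+ p = 1 &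
      forall n, ~~ (p %| n) -> dsupp (v ^+ n) k].
Proof.
move=> p_pr; pose q : prime_number := exist _ p p_pr.
have [z [zp zn]] := quasicyclic_order q.
have [b [bk b1]] := @direct_sum_single K (fun=> quasicyclic q) k z.
have [c [cq c1]] := @direct_sum_single prime_number
  (fun q => direct_sum (fun _ : K => quasicyclic q)) q b.
have bp : b ^+ p = 1.
  apply: entry_ext => j; rewrite entryX.
  by have [->|/b1 ->] := pselect (j = k); rewrite ?bk ?zp// expg1n.
exists (1, c); split.
- move=> j [[]//|[r]]; rewrite /torsion_entry /=.
  have [->|/c1 ->//] := pselect (r = q); rewrite cq => bj.
  by apply: contrapT => /b1.
- rewrite divisible_sumX expg1n; congr pair; apply: entry_ext => r.
  rewrite entryX; have [->|/c1 ->] := pselect (r = q).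
    by rewrite cq bp.
  by rewrite expg1n.
- move=> n pn; right; exists q; rewrite torsion_entryX /torsion_entry /= cq bk.
  exact: zn.
Qed.

Lemma abelian_embedding_divisible_sum (B : groupType) (e : B -> K) :
  abelian_group B -> injective e ->
  exists2 f : B -> D, {morph f : x y / x * y} & injective f.
Proof.
move=> Bab e_inj.
apply: (embedding_in_divisible Bab divisible_sum_abelian e_inj).
- exact: dsupp1.
- exact: dsuppF.
- exact: dsupp_div.
- exact: dsupp_free.
- exact: dsupp_tors.
Qed.

Lemma card_divisible_sum : infinite_set [set: K] -> [set: D] #<= [set: K].
Proof.
move=> Kinf; apply: card_le_prod => //.
  by apply: card_direct_sum => // _; exact: card_le_countType.
apply: card_direct_sum => //; first exact: card_le_countType.
move=> p; apply: card_direct_sum => // _.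
apply: (card_le_injT Kinf (f := (val : quasicyclic p -> algC))).
  exact: val_inj.
exact: card_le_countType.
Qed.

End DivisibleSum.

(** * Subgroups of symmetric groups and of products *)

Lemma sym_subgroup_pointwise (G : topologicalGroupType) (Omega : Type) :
  isomorphic_to_subgroup G (Sym Omega) ->
  exists2 c : Omega -> G -> Omega, pointwise_topology c &
    forall k x y, c k x = c k 1 -> c k y = c k 1 -> c k (x / y) = c k 1.
Proof.
move=> /isomorphic_to_subgroupP[f [fM _ fE]].
exists (fun k x => sym_fun (f x) k).
  exact/(pointwise_embeddingP f (@sym_pointwise Omega)).
move=> k x y; rewrite (morph_mulg1 fM) => fx fy.
have fyV : sym_inv_fun (f y) k = k.
  by rewrite -[in LHS](fy : sym_fun (f y) k = k) sym_funK.
rewrite fM (morph_mulgV fM) -fx.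
by change (sym_fun (f x) (sym_inv_fun (f y) k) = sym_fun (f x) k); rewrite fyV.
Qed.

Lemma product_subgroup_TNA (G : topologicalGroupType) {I : Type}
    (H : I -> groupType) :
  isomorphic_to_subgroup G
    (direct_product (fun i => discrete_topology (H i))) ->
  TNA G.
Proof.
move=> /product_subgroupP[c [cM cp _]]; apply: (pointwise_TNA cp) => i x y.
rewrite (morph_mulg1 (cM i)) => cx cy.
by rewrite cM (morph_mulgV (cM i)) cx cy mulgV.
Qed.

(** The factors H i need not be abelian, so each is first replaced by the image
    of A, which is embedded into the divisible sum. The index set is enlarged
    to K by trivial homomorphisms. *)
Lemma product_divisible_sum {A : topologicalGroupType} {I K : Type}
    (H : I -> groupType) : infinite_set [set: K] -> abelian_group A ->
  [set: I] #<= [set: K] -> (forall i, [set: H i] #<= [set: K]) ->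
  isomorphic_to_subgroup A
    (direct_product (fun i => discrete_topology (H i))) ->
  isomorphic_to_subgroup A
    (direct_product (fun _ : K => discrete_topology (divisible_sum K))).
Proof.
move=> Kinf Aab IK HK /product_subgroupP[c [cM cp c_inj]].
have [k0 _] := infinite_inhabited Kinf.
have [e e_inj] := (card_leTP k0).1 IK.
have hP i : exists h : A -> divisible_sum K, {morph h : x y / x * y} /\
    forall x y, h x = h y <-> c i x = c i y.
  have rg : group_closed [in range (c i)].
    split; first by rewrite inE -(morph_mulg1 (cM i)); exists 1.
    move=> x y; rewrite !inE => -[a _ <-] [b _ <-].
    by rewrite -(morph_mulgV (cM i)) -cM; exists (a / b).
  pose B := Subgroup rg.
  pose cB x : B := SigSub (mem_set (imageT (c i) x)).
  have cBM x y : cB (x * y) = cB x * cB y by apply: val_inj; rewrite /= cM.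
  have cBE x y : cB x = cB y <-> c i x = c i y.
    by split=> [/(congr1 val)|xy]; last exact: val_inj.
  have Bab : abelian_group B.
    have Bx (b : B) : exists x, cB x = b.
      case: b => b b_in; have := set_mem b_in; case=> x _ xb.
      by exists x; exact: val_inj.
    move=> b b'; have [x <-] := Bx b; have [y <-] := Bx b'.
    by rewrite -!cBM Aab.
  have [d d_inj] := (card_leTP k0).1 (HK i).
  have [f fM f_inj] := abelian_embedding_divisible_sum
    (e := fun b : B => d (val b)) Bab (inj_comp d_inj val_inj).
  exists (f \o cB); split=> [x y|x y] /=; first by rewrite cBM fM.
  by rewrite -cBE; split=> [/f_inj|->].
have /choice[h {}hP] : forall k, exists h : A -> divisible_sum K,
    [/\ {morph h : x y / x * y}, forall x, nbhs x [set y | h y = h x] &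
        forall i, e i = k -> forall x y, h x = h y -> c i x = c i y].
  move=> k; have [[i ik]|nk] := pselect (exists i, e i = k); last first.
    exists (fun=> 1); split=> [x y|x|i ik]; first by rewrite mulg1.
      by apply: nearW.
    by case: nk; exists i.
  have [h [hM hc]] := hP i; exists h; split=> // [x|j]; last first.
    by rewrite -ik => /e_inj -> x y /hc.
  have := agree_on_nbhs x cp (finite_set1 i).
  by apply: filterS => y /(_ i erefl)/hc.
have sep i : exists k, forall x y, h k x = h k y -> c i x = c i y.
  by exists (e i); have [_ _ /(_ i erefl)] := hP (e i).
apply/product_subgroupP; exists h; split.
- by move=> k; have [] := hP k.
- by apply: (pointwise_refine cp) => // k; have [] := hP k.
- move=> x y hxy; apply: c_inj => i; have [k] := sep i; apply; exact: hxy.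
Qed.

Lemma product_subgroup_weight {G : topologicalGroupType} {K : Type}
    {H : groupType} : infinite_set [set: K] -> [set: H] #<= [set: K] ->
  isomorphic_to_subgroup G
    (direct_product (fun _ : K => discrete_topology H)) ->
  weight G #<= [set: K].
Proof.
by move=> Kinf HK /product_subgroupP[c [_ + _]]; exact: pointwise_weight.
Qed.

Lemma weight_invariants {X : topologicalType} {K : Type} :
  infinite_set [set: K] -> weight X #<= [set: K] ->
  cellularity X #<= [set: K] /\ character X #<= [set: K].
Proof.
by move=> Kinf XK; split; [exact: weight_cellularity|exact: weight_character].
Qed.

Lemma small_subgroup_base {G : topologicalGroupType} {K : Type} :
  infinite_set [set: K] -> TNA G -> cellularity G #<= [set: K] ->
  character G #<= [set: K] -> exists (I : Type) (S : I -> subgroup G),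
    [/\ subgroup_base S, [set: I] #<= [set: K] &
        forall i, range (coset (S i)) #<= [set: K]].
Proof.
move=> Kinf GT GK /(character_leP Kinf)/(_ 1)[V Vb VK].
have [S Sb] := TNA_subgroup_base GT Vb; exists V, S; split=> //.
  by rewrite (card_le_eql (card_setT V)).
by move=> i; apply: card_cosets => //; case: Sb.
Qed.

(** * The characterizations *)

Theorem theorem3p1 :
  ((forall G : topologicalGroupType, hausdorff_space G ->
      (TNA G <-> exists Omega : Type, isomorphic_to_subgroup G (Sym Omega)))
   /\
   (forall (G : topologicalGroupType) (K : Type),
      hausdorff_space G -> infinite_set [set: K] ->
      [<-> isomorphic_to_subgroup G (Sym K);
           TNA G /\ weight G #<= [set: K];
           [/\ TNA G, cellularity G #<= [set: K] & character G #<= [set: K]]]))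
  /\
  ((forall A : topologicalGroupType, hausdorff_space A -> abelian_group A ->
      (TNA A <->
       exists (I : Type) (H : I -> groupType),
         isomorphic_to_subgroup A
           (direct_product (fun i => discrete_topology (H i)))))
   /\
   (forall (A : topologicalGroupType) (K : Type),
      hausdorff_space A -> abelian_group A -> infinite_set [set: K] ->
      [<-> exists (I : Type) (H : I -> groupType),
             [/\ [set: I] #<= [set: K],
                 forall i, [set: H i] #<= [set: K] &
                 isomorphic_to_subgroup A
                   (direct_product (fun i => discrete_topology (H i)))];
           isomorphic_to_subgroup A
             (direct_product (fun _ : K => discrete_topology (divisible_sum K)));
           TNA A /\ weight A #<= [set: K];
           [/\ TNA A, cellularity A #<= [set: K] & character A #<= [set: K]]])).
Proof.
split; split.
- move=> G GH; split=> [GT|[Omega /sym_subgroup_pointwise[c cp cM]]]; last first.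
    exact: pointwise_TNA cp cM.
  have [S Sb] := TNA_subgroup_base GT (local_base_open_nbhs 1).
  by exists (set G); apply: (subgroup_base_sym (e := id) GH Sb).
- move=> G K GH Kinf; tfae.
  + move=> /sym_subgroup_pointwise[c cp cM].
    split; first exact: pointwise_TNA cp cM.
    exact: pointwise_weight cp.
  + by move=> [GT /(weight_invariants Kinf)[]].
  + move=> [GT GC GX].
    have [I [S [Sb IK SK]]] := small_subgroup_base Kinf GT GC GX.
    have [k0 _] := infinite_inhabited Kinf.
    have /(card_le_injP _ k0)[e e_inj] :
        \bigcup_i range (coset (S i)) #<= [set: K].
      by apply: card_le_bigcup => // i _.
    exact: subgroup_base_sym e_inj.
- move=> A AH Aab; split=> [AT|[I [H /product_subgroup_TNA//]]].
  have [S Sb] := TNA_subgroup_base AT (local_base_open_nbhs 1).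
  have [H [_ AE]] := subgroup_base_product AH Aab Sb.
  by exists (set_type (open_nbhs (1 : A))), H.
- move=> A K AH Aab Kinf; tfae.
  + by move=> [I [H [IK HK]]]; exact: product_divisible_sum.
  + move=> AE; split; first exact: product_subgroup_TNA AE.
    apply: product_subgroup_weight AE => //; exact: card_divisible_sum.
  + by move=> [AT /(weight_invariants Kinf)[]].
  + move=> [AT AC AX].
    have [I [S [Sb IK SK]]] := small_subgroup_base Kinf AT AC AX.
    have [H [HS AE]] := subgroup_base_product AH Aab Sb.
    by exists I, H; split=> // i; exact: card_le_trans (HS i) (SK i).
Qed.
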